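(* Let $\mathcal{G}$ be a noncompact metric graph in the class $\mathbf{G}$ with finitely many edges, no pendant and exactly one half-line. Then there exists $\delta>0$ such that for every $p\in[6,6+\delta]$ there exists $\mu>0$, depending on $p$ and $\mathcal{G}$, for which problem \[ \begin{cases} u''+u^{p-1}=\lambda u & \text{on every edge of }\mathcal{G},\\ u\in H^1(\mathcal{G}),\ u>0 & \text{on }\mathcal{G},\\ \sum_{e\succ \mathrm{v}}\frac{du}{dx_e}(\mathrm{v})=0 & \text{for every vertex }\mathrm{v}, \end{cases} \] admits a positive solution $u\in H^1_\mu(\mathcal{G})$ (for some $\lambda\in\mathbb R$) with $E(u,\mathcal{G})<0$.
   Context: A metric graph $\mathcal{G}=(\mathbb{V},\mathbb{E})$ belongs to the class $\mathbf{G}$ if it is connected, has at most countably many edges, every vertex has finite degree, and $\inf_{e\in\mathbb{E}}|e|>0$. Noncompact means it has at least one half-line or infinitely many edges. A pendant is a bounded edge one of whose vertices has degree $1$. $H^1(\mathcal{G})$ is the space of continuous functions on $\mathcal{G}$, $H^1$ on each edge, with finite $H^1$ norm; $H^1_\mu(\mathcal{G})=\{v\in H^1(\mathcal{G}):\|v\|_{L^2}^2=\mu\}$; $E(u,\mathcal{G})=\frac12\|u'\|_{L^2(\mathcal G)}^2-\frac1p\|u\|_{L^p(\mathcal G)}^p$. The vertex condition is the Kirchhoff condition: sum over edges $e$ incident at $\mathrm v$ of the outgoing derivatives of $u$ at $\mathrm v$ equals zero.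
   Formalization: The graph is additionally assumed to have at least one bounded edge; this excludes only the bare half-line, where the claim fails since its only positive solutions are half-solitons, with energy 0 at p=6 and positive energy for p>6. *)

(* Defs.v *)
From Stdlib Require Import Reals List Arith Relations.
From Coquelicot Require Import Coquelicot.
Open Scope R_scope.

(* A metric graph with finitely many edges.
   Vertices: 0 .. nV-1.
   Bounded edges: 0 .. nE-1; edge e is identified with [0, len e], the point 0
     corresponding to vertex orig e and the point len e to vertex term e
     (loops and multiple edges allowed).
   Half-lines: 0 .. nH-1; half-line h is identified with [0, +oo), the point 0
     corresponding to vertex hvert h. *)
Record MGraph := {
  nV : nat;
  nE : nat;
  orig : nat -> nat;
  term : nat -> nat;
  len : nat -> R;
  nH : nat;
  hvert : nat -> nat }.

Definition wf_graph (G : MGraph) : Prop :=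
  (forall e, (e < nE G)%nat ->
     (orig G e < nV G)%nat /\ (term G e < nV G)%nat /\ 0 < len G e) /\
  (forall h, (h < nH G)%nat -> (hvert G h < nV G)%nat).

Definition nsum (n : nat) (f : nat -> nat) : nat :=
  fold_right Nat.add 0%nat (map f (seq 0 n)).

Definition rsum (n : nat) (f : nat -> R) : R :=
  fold_right Rplus 0 (map f (seq 0 n)).

Definition deg (G : MGraph) (v : nat) : nat :=
  (nsum (nE G) (fun e => (if Nat.eqb (orig G e) v then 1 else 0) +
                         (if Nat.eqb (term G e) v then 1 else 0)) +
   nsum (nH G) (fun h => if Nat.eqb (hvert G h) v then 1 else 0))%nat.

Definition adj (G : MGraph) (v w : nat) : Prop :=
  exists e, (e < nE G)%nat /\
    ((orig G e = v /\ term G e = w) \/ (orig G e = w /\ term G e = v)).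

Definition connected (G : MGraph) : Prop :=
  forall v w, (v < nV G)%nat -> (w < nV G)%nat -> clos_refl_trans nat (adj G) v w.

Definition no_pendant (G : MGraph) : Prop :=
  forall e, (e < nE G)%nat -> deg G (orig G e) <> 1%nat /\ deg G (term G e) <> 1%nat.

(* (ub e, dub e) : u and u' on bounded edge e; (uh h, duh h) : u and u' on
   half-line h.  [nls_solution G p lam ub dub uh duh] : u is a positive
   H^1(G) solution of  u'' + u^(p-1) = lam u  on every edge, with Kirchhoff
   conditions at the vertices. *)
Definition nls_solution (G : MGraph) (p lam : R)
    (ub dub uh duh : nat -> R -> R) : Prop :=
  (forall e x, (e < nE G)%nat -> 0 <= x <= len G e ->
     0 < ub e x /\ is_derive (ub e) x (dub e x) /\
     is_derive (dub e) x (lam * ub e x - Rpower (ub e x) (p - 1))) /\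
  (forall h x, (h < nH G)%nat -> 0 <= x ->
     0 < uh h x /\ is_derive (uh h) x (duh h x) /\
     is_derive (duh h) x (lam * uh h x - Rpower (uh h x) (p - 1))) /\
  (* H^1 (and hence L^p) integrability on half-lines *)
  (forall h, (h < nH G)%nat ->
     ex_RInt_gen (fun x => (uh h x) ^ 2) (at_point 0) (Rbar_locally p_infty) /\
     ex_RInt_gen (fun x => (duh h x) ^ 2) (at_point 0) (Rbar_locally p_infty) /\
     ex_RInt_gen (fun x => Rpower (uh h x) p) (at_point 0) (Rbar_locally p_infty)) /\
  (exists phi : nat -> R,
     (forall e, (e < nE G)%nat -> ub e 0 = phi (orig G e) /\ ub e (len G e) = phi (term G e)) /\
     (forall h, (h < nH G)%nat -> uh h 0 = phi (hvert G h))) /\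
  (forall v, (v < nV G)%nat ->
     rsum (nE G) (fun e => (if Nat.eqb (orig G e) v then dub e 0 else 0) +
                           (if Nat.eqb (term G e) v then - dub e (len G e) else 0)) +
     rsum (nH G) (fun h => if Nat.eqb (hvert G h) v then duh h 0 else 0) = 0).

Definition mass (G : MGraph) (ub uh : nat -> R -> R) : R :=
  rsum (nE G) (fun e => RInt (fun x => (ub e x) ^ 2) 0 (len G e)) +
  rsum (nH G) (fun h => RInt_gen (fun x => (uh h x) ^ 2) (at_point 0) (Rbar_locally p_infty)).

(* E(u,G) = 1/2 ||u'||_2^2 - 1/p ||u||_p^p  (for positive u) *)
Definition energy (G : MGraph) (p : R) (ub dub uh duh : nat -> R -> R) : R :=
  / 2 * (rsum (nE G) (fun e => RInt (fun x => (dub e x) ^ 2) 0 (len G e)) +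
         rsum (nH G) (fun h => RInt_gen (fun x => (duh h x) ^ 2) (at_point 0) (Rbar_locally p_infty)))
  - / p * (rsum (nE G) (fun e => RInt (fun x => Rpower (ub e x) p) 0 (len G e)) +
           rsum (nH G) (fun h => RInt_gen (fun x => Rpower (uh h x) p) (at_point 0) (Rbar_locally p_infty))).

(* Main.v *)
Require Import Defs.
From Stdlib Require Import Reals.
From Coquelicot Require Import Coquelicot.
From Stdlib Require Import List Arith Relations Permutation Lia Lra Psatz.
From Stdlib Require Import Classical IndefiniteDescription.
Open Scope R_scope.

(** The solution bifurcates from [0].  Put [u = eta v], [eta^(p-2) = kap],
    [lam = kap s], so that [v'' = kap (s v - v^(p-1))], and normalise [v = 1] at
    the vertex [v0] of the half-line.  For small [kap], uniformly in [p] in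
    [[6,7]], the compact core carries a solution [v = 1 + kap z] close to [1]
    (Banach fixed point for the Green operator with Dirichlet condition at [v0]),
    and the half-line carries a soliton tail; the two match at [v0] when
    [s = 2/p + kap n^2], where [D = kap n] is the flux entering the core.

    With [A = int v'^2] over the core and [K] the length of the core, the energy
    is at most [(3 A - K D^2) / 4 + O(p - 6)].  To leading order [- z'' = 1 - 2/p],
    and by duality [int z'^2] is at most [(1 - 2/p)^2 int q^2] for every flow [q]
    with [- q' = 1] that satisfies Kirchhoff's rule away from [v0].  Transporting
    the edges one by one into [v0] gives [int q^2 <= K^3 / 3], the value of a
    segment attached at [v0]; the inequality is strict because, in the absence of
    pendants, the last edge closes a cycle and can be drained through both ends.
    Hence [3 A - K D^2 < 0] at order [kap^2], and this survives for [p] close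
    to [6] once [kap] is fixed. *)

(** * Flows and Laplacian on the compact core *)

(** The obstacle is a cancellation. On the half-line the first integral v'^2 = kap (s v^2 - (2/p)
    v^p) makes the energy equal to D/4 plus a multiple of p - 6; the core contributes at most - D/4
    + (3 A - K D^2)/4 plus another such multiple. The terms of order kap cancel exactly, so the sign
    is decided at order kap^2. The same first integral at v = 1 with slope - D is the origin of s =
    2/p + kap n^2. A segment is the borderline case: with r = 1 - 2/p and z' = r (K - x) one gets 3
    A = kap^2 r^2 K^3 = K D^2. A strict saving [gap] over the segment is therefore secured first,
    from the graph alone. Then [kap] is fixed, uniformly in p, so that errors of relative order kap
    stay below [gap]. Only then is [delta] chosen, because the half-line integral of v^p is
    controlled only by 4 / sqrt kap and its multiple by p - 6 must stay below order kap^2. The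
    frequency s depends on the flux and the flux on the profile, so s is made part of the unknown:
    one fixed point solves the core equation and the matching together. *)

Definition lsum (l : list nat) (f : nat -> R) : R := fold_right Rplus 0 (map f l).

Lemma lsum_ext l f g : (forall e, In e l -> f e = g e) -> lsum l f = lsum l g.
Proof.
  intros H; unfold lsum; f_equal; apply map_ext_in; exact H.
Qed.

Lemma lsum_plus l f g : lsum l (fun e => f e + g e) = lsum l f + lsum l g.
Proof. unfold lsum; induction l; simpl; [ring|rewrite IHl; ring]. Qed.

Lemma lsum_scal l c f : lsum l (fun e => c * f e) = c * lsum l f.
Proof. unfold lsum; induction l; simpl; [ring|rewrite IHl; ring]. Qed.

Lemma lsum_le l f g : (forall e, In e l -> f e <= g e) -> lsum l f <= lsum l g.
Proof.
  unfold lsum; induction l as [|a l IH]; simpl; intros H; [lra|].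
  apply Rplus_le_compat; auto.
Qed.

Lemma lsum_zero l f : (forall e, In e l -> f e = 0) -> lsum l f = 0.
Proof.
  unfold lsum; induction l as [|a l IH]; simpl; intros H; [lra|].
  rewrite H, IH; auto; ring.
Qed.

Lemma lsum_nonneg l f : (forall e, In e l -> 0 <= f e) -> 0 <= lsum l f.
Proof.
  intros H; rewrite <- (lsum_zero l (fun _ => 0)); auto; apply lsum_le; exact H.
Qed.

Lemma lsum_abs l f : Rabs (lsum l f) <= lsum l (fun e => Rabs (f e)).
Proof.
  unfold lsum; induction l as [|a l IH]; simpl; [rewrite Rabs_R0; lra|].
  eapply Rle_trans; [apply Rabs_triang|lra].
Qed.

Lemma lsum_perm l l' f : Permutation l l' -> lsum l f = lsum l' f.
Proof. unfold lsum; induction 1; simpl; lra. Qed.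

Lemma lsum_exchange l l' f :
  lsum l (fun i => lsum l' (f i)) = lsum l' (fun j => lsum l (fun i => f i j)).
Proof.
  induction l as [|a l IH].
  - symmetry; apply lsum_zero; reflexivity.
  - change (lsum l' (f a) + lsum l (fun i => lsum l' (f i)) =
            lsum l' (fun j => f a j + lsum l (fun i => f i j))).
    now rewrite lsum_plus, IH.
Qed.

Lemma lsum_indicator l y c :
  NoDup l -> In y l -> lsum l (fun v => if Nat.eqb y v then c v else 0) = c y.
Proof.
  induction l as [|a l IH]; intros Hn Hy; [contradiction|].
  change ((if Nat.eqb y a then c a else 0) +
          lsum l (fun v => if Nat.eqb y v then c v else 0) = c y).
  inversion Hn as [|? ? Ha Hl]; subst.
  destruct (Nat.eqb_spec y a) as [->|Hya].
  - rewrite lsum_zero; [ring|]. intros e He.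
    destruct (Nat.eqb_spec a e); [subst; contradiction|reflexivity].
  - destruct Hy as [Hy|Hy]; [congruence|]. rewrite IH; auto; ring.
Qed.

Lemma rsum_indicator n y c :
  (y < n)%nat -> rsum n (fun v => if Nat.eqb y v then c v else 0) = c y.
Proof.
  intros Hy; apply lsum_indicator; [apply seq_NoDup|apply in_seq; lia].
Qed.

(** Kirchhoff sum at [v]: [a e] and [b e] are the values at the origin and at the terminal end of
    [e], both oriented into the edge, so that a loop contributes both. *)
Definition vdiv (G : MGraph) (l : list nat) (a b : nat -> R) (v : nat) : R :=
  lsum l (fun e => (if Nat.eqb (orig G e) v then a e else 0) +
                   (if Nat.eqb (term G e) v then b e else 0)).

Definition reach (G : MGraph) (v0 : nat) (l : list nat) (v : nat) : Prop :=
  v = v0 \/ exists e, In e l /\ (orig G e = v \/ term G e = v).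

(* An order in which the edges can be glued one after the other, so that every
   partial graph is connected and contains [v0]; the last edge is the head. *)
Inductive grown (G : MGraph) (v0 : nat) : list nat -> Prop :=
| grown_nil : grown G v0 nil
| grown_cons e l : grown G v0 l -> ~ In e l ->
    reach G v0 l (orig G e) \/ reach G v0 l (term G e) -> grown G v0 (e :: l).

Lemma vdiv_cons G e l a b v :
  vdiv G (e :: l) a b v =
  (if Nat.eqb (orig G e) v then a e else 0) + (if Nat.eqb (term G e) v then b e else 0) +
  vdiv G l a b v.
Proof. reflexivity. Qed.

Lemma vdiv_ext G l a b a' b' v :
  (forall e, In e l -> a e = a' e /\ b e = b' e) -> vdiv G l a b v = vdiv G l a' b' v.
Proof.
  intros H; apply lsum_ext; intros e He; destruct (H e He) as [-> ->]; reflexivity.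
Qed.

Lemma vdiv_plus G l a b a' b' v :
  vdiv G l (fun e => a e + a' e) (fun e => b e + b' e) v = vdiv G l a b v + vdiv G l a' b' v.
Proof.
  unfold vdiv; rewrite <- lsum_plus; apply lsum_ext; intros e _.
  destruct (Nat.eqb _ _), (Nat.eqb _ _); ring.
Qed.

Lemma vdiv_scal G l c a b v :
  vdiv G l (fun e => c * a e) (fun e => c * b e) v = c * vdiv G l a b v.
Proof.
  unfold vdiv; rewrite <- lsum_scal; apply lsum_ext; intros e _.
  destruct (Nat.eqb _ _), (Nat.eqb _ _); ring.
Qed.

Lemma vdiv_unreached G v0 l a b v : ~ reach G v0 l v -> vdiv G l a b v = 0.
Proof.
  intros H; apply lsum_zero; intros e He.
  destruct (Nat.eqb_spec (orig G e) v), (Nat.eqb_spec (term G e) v); try lra;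
    exfalso; apply H; right; exists e; auto.
Qed.

(** Discrete integration by parts, obtained by exchanging the sums over edges and vertices. It turns
    the boundary terms of edgewise integrations by parts into Kirchhoff sums; with [phi] constant it
    is a divergence theorem. *)
Lemma vdiv_by_parts G l (phi a b : nat -> R) :
  (forall e, In e l -> (orig G e < nV G)%nat /\ (term G e < nV G)%nat) ->
  lsum l (fun e => phi (orig G e) * a e + phi (term G e) * b e) =
  rsum (nV G) (fun v => phi v * vdiv G l a b v).
Proof.
  intros Hw. unfold vdiv.
  change (rsum (nV G)) with (lsum (seq 0 (nV G))).
  rewrite (lsum_ext (seq 0 (nV G)) _ (fun v => lsum l (fun e =>
     (if Nat.eqb (orig G e) v then phi v * a e else 0) +
     (if Nat.eqb (term G e) v then phi v * b e else 0)))).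
  2:{ intros v _; rewrite <- lsum_scal; apply lsum_ext; intros e _.
      destruct (Nat.eqb _ _), (Nat.eqb _ _); ring. }
  rewrite <- lsum_exchange; apply lsum_ext; intros e He.
  destruct (Hw e He) as [Ho Ht].
  rewrite lsum_plus. f_equal; symmetry.
  - exact (rsum_indicator _ _ (fun v => phi v * a e) Ho).
  - exact (rsum_indicator _ _ (fun v => phi v * b e) Ht).
Qed.

Lemma reach_cons G v0 e l v :
  reach G v0 (e :: l) v <-> reach G v0 l v \/ orig G e = v \/ term G e = v.
Proof.
  unfold reach; split.
  - intros [H|[e' [[->|He] H]]]; [auto|auto|left; right; exists e'; auto].
  - intros [[H|[e' [He H]]]|H]; [auto|right; exists e'; simpl; auto|].
    right; exists e; simpl; auto.
Qed.

(** The third hypothesis makes [l] saturated: an edge touching the reached set already belongs to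
    [l]. A path from [v0] can then never leave the reached set. *)
Lemma connected_reach G v0 l :
  connected G -> (v0 < nV G)%nat ->
  (forall e, (e < nE G)%nat -> reach G v0 l (orig G e) \/ reach G v0 l (term G e) -> In e l) ->
  forall v, (v < nV G)%nat -> reach G v0 l v.
Proof.
  intros Hc Hv0 Hl v Hv.
  assert (Hp : forall x y, clos_refl_trans nat (adj G) x y -> reach G v0 l x -> reach G v0 l y).
  { induction 1 as [x y [e [He Hxy]]| |]; auto.
    intros Hx; right; exists e; split; [apply Hl; auto|]; destruct Hxy as [[-> ->]|[-> ->]]; auto. }
  apply (Hp v0 v); [apply Hc; auto|left; reflexivity].
Qed.

Lemma grown_NoDup G v0 l : grown G v0 l -> NoDup l.
Proof. induction 1; constructor; auto. Qed.

(** Greedy growth. If no new edge touches the reached set, saturation and connectedness put every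
    edge into [l], against a length below [nE G]. *)
Lemma exists_grown G v0 :
  wf_graph G -> connected G -> (v0 < nV G)%nat ->
  exists l, grown G v0 l /\ Permutation l (seq 0 (nE G)).
Proof.
  intros [Hw _] Hc Hv0.
  assert (H : forall k, (k <= nE G)%nat -> exists l, grown G v0 l /\ incl l (seq 0 (nE G)) /\ length l = k).
  { induction k as [|k IH]; intros Hk.
    - exists nil; split; [constructor|split; [intros x []|reflexivity]].
    - destruct IH as [l [Hg [Hi Hlen]]]; [lia|].
      destruct (classic (exists e, (e < nE G)%nat /\ ~ In e l /\
        (reach G v0 l (orig G e) \/ reach G v0 l (term G e)))) as [[e [He [Hel Hr]]]|Hno].
      + exists (e :: l); split; [constructor; auto|split; [|simpl; lia]].
        intros x [<-|Hx]; [apply in_seq; lia|auto].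
      + exfalso.
        assert (Hall : forall e, (e < nE G)%nat ->
           reach G v0 l (orig G e) \/ reach G v0 l (term G e) -> In e l).
        { intros e He Hr; destruct (classic (In e l)); auto; exfalso; apply Hno; exists e; auto. }
        assert (Hincl : incl (seq 0 (nE G)) l).
        { intros e He; apply in_seq in He. apply Hall; [lia|].
          left; apply (connected_reach G v0 l Hc Hv0 Hall). apply Hw; lia. }
        generalize (NoDup_incl_length (seq_NoDup (nE G) 0) Hincl).
        rewrite length_seq; lia. }
  destruct (H (nE G)) as [l [Hg [Hi Hlen]]]; [lia|].
  exists l; split; auto.
  apply NoDup_Permutation_bis; auto; [eapply grown_NoDup; eauto|rewrite length_seq; lia].
Qed.

(* Along edge [e] the flow has derivative -1; [al e] and [len e - al e] are its
   values at the two ends, oriented into the edge, and the vertex [v] carries an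
   additional load [m v].  Since [al + (len - al) = len > 0], three times the
   integral of the squared flow over [e] is [al^3 + (len - al)^3]. *)
Definition flow_bound (G : MGraph) (v0 : nat) (l : list nat) (gain : R) : Prop :=
  forall m : nat -> R, (forall v, 0 <= m v) ->
  exists al : nat -> R,
    (forall v, v <> v0 -> reach G v0 l v ->
       vdiv G l al (fun e => len G e - al e) v = - m v) /\
    lsum l (fun e => al e ^ 3 + (len G e - al e) ^ 3) + gain <=
      (lsum l (len G) + rsum (nV G) m) ^ 3 - rsum (nV G) m ^ 3.

Lemma load_push n m y c :
  (y < n)%nat ->
  rsum n (fun v => m v + (if Nat.eqb y v then c else 0)) = rsum n m + c.
Proof.
  intros Hy; change (rsum n) with (lsum (seq 0 n)); rewrite lsum_plus; f_equal.
  exact (rsum_indicator n y (fun _ => c) Hy).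
Qed.

Lemma rsum_ge_term n m x : (forall v, 0 <= m v) -> (x < n)%nat -> m x <= rsum n m.
Proof.
  intros Hm Hx. rewrite <- (rsum_indicator n x m Hx).
  apply lsum_le; intros v _. destruct (Nat.eqb x v); [lra|apply Hm].
Qed.

Definition upd (f : nat -> R) (i : nat) (c : R) : nat -> R :=
  fun j => if Nat.eqb j i then c else f j.

Lemma upd_eq f i c : upd f i c i = c.
Proof. unfold upd; now rewrite Nat.eqb_refl. Qed.

Lemma upd_neq f i c j : j <> i -> upd f i c j = f j.
Proof. intros H; unfold upd; now rewrite (proj2 (Nat.eqb_neq j i) H). Qed.


Lemma vdiv_cons_upd G e l a b v ca cb : ~ In e l ->
  vdiv G (e :: l) (upd a e ca) (upd b e cb) v =
  (if Nat.eqb (orig G e) v then ca else 0) + (if Nat.eqb (term G e) v then cb else 0) +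
  vdiv G l a b v.
Proof.
  intros He; rewrite vdiv_cons, !upd_eq; f_equal; apply vdiv_ext.
  intros e' He'; rewrite !upd_neq; [auto| |]; intros ->; contradiction.
Qed.

Lemma flow_cons_upd G e l al c :
  ~ In e l ->
  (forall v, vdiv G (e :: l) (upd al e c) (fun e' => len G e' - upd al e c e') v =
     (if Nat.eqb (orig G e) v then c else 0) + (if Nat.eqb (term G e) v then len G e - c else 0)
     + vdiv G l al (fun e' => len G e' - al e') v) /\
  lsum (e :: l) (fun e' => upd al e c e' ^ 3 + (len G e' - upd al e c e') ^ 3) =
    c ^ 3 + (len G e - c) ^ 3 + lsum l (fun e' => al e' ^ 3 + (len G e' - al e') ^ 3).
Proof.
  intros He; split.
  - intros v; rewrite <- vdiv_cons_upd by assumption; apply vdiv_ext.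
    intros e' _; split; [reflexivity|]; unfold upd.
    destruct (Nat.eqb_spec e' e) as [->|_]; reflexivity.
  - change (lsum (e :: l) ?f) with (f e + lsum l f); cbv beta.
    rewrite upd_eq; f_equal; apply lsum_ext.
    intros e' He'; rewrite upd_neq; [reflexivity|]; intros ->; contradiction.
Qed.

(** The edge is drained symmetrically: half of its length leaves through each end and is added to
    the load there. This costs len^3 / 4, whereas a piece of segment carrying the total load M would
    cost (M + len)^3 - M^3, which is at least len^3; hence the gain. *)
Lemma flow_bound_cycle G v0 e l :
  ~ In e l -> (orig G e < nV G)%nat -> (term G e < nV G)%nat -> 0 < len G e ->
  (forall e, In e l -> 0 < len G e) ->
  reach G v0 l (orig G e) -> reach G v0 l (term G e) ->
  flow_bound G v0 l 0 -> flow_bound G v0 (e :: l) (len G e ^ 3 * (3 / 4)).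
Proof.
  intros He Ho Ht Hl Hpos Hro Hrt IH m Hm.
  set (h := len G e / 2).
  destruct (IH (fun v => (m v + (if Nat.eqb (orig G e) v then h else 0)) +
                         (if Nat.eqb (term G e) v then h else 0))) as [al [Hal Hc]].
  { intros v; generalize (Hm v); unfold h; destruct (Nat.eqb _ _), (Nat.eqb _ _); lra. }
  destruct (flow_cons_upd G e l al h He) as [Hv Hs].
  exists (upd al e h); split.
  - intros v Hv0 Hr; rewrite Hv, Hal; auto.
    + replace (len G e - h) with h by (unfold h; field). ring.
    + apply reach_cons in Hr; destruct Hr as [Hr|[<-|<-]]; auto.
  - rewrite Hs; clear Hs Hv Hal.
    rewrite !load_push in Hc by assumption.
    change (lsum (e :: l) (len G)) with (len G e + lsum l (len G)).
    assert (HM : 0 <= rsum (nV G) m) by (apply lsum_nonneg; auto).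
    revert Hc HM; generalize (lsum l (fun e => al e ^ 3 + (len G e - al e) ^ 3)).
    generalize (rsum (nV G) m) (lsum l (len G)); intros M S T.
    replace (M + h + h) with (M + len G e) by (unfold h; field).
    replace (S + (M + len G e)) with (len G e + S + M) by ring. intros Hc HM.
    assert (h ^ 3 + (len G e - h) ^ 3 = len G e ^ 3 / 4) by (unfold h; field).
    assert (len G e ^ 3 <= (M + len G e) ^ 3 - M ^ 3).
    { assert (0 <= M * len G e * (M + len G e)) by (repeat apply Rmult_le_pos; lra). nra. }
    lra.
Qed.

(** The new vertex [x] can only be drained through [e], so [len G e + m x] is passed on to the
    reached end [y]. Since [m x] is at most the total load M, the cost is at most (M + len)^3 - M^3.
    The abstract end value [c] covers both orientations of [e]. *)
Lemma flow_bound_leaf G v0 e l x y c :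
  ~ In e l -> (x < nV G)%nat -> (y < nV G)%nat -> 0 < len G e ->
  reach G v0 l y -> ~ reach G v0 l x ->
  (forall v, reach G v0 (e :: l) v -> reach G v0 l v \/ v = x) ->
  (forall m, (forall v,
     (if Nat.eqb (orig G e) v then c m else 0) +
     (if Nat.eqb (term G e) v then len G e - c m else 0) =
     (if Nat.eqb y v then len G e + m x else 0) + (if Nat.eqb x v then - m x else 0)) /\
     c m ^ 3 + (len G e - c m) ^ 3 = (len G e + m x) ^ 3 - m x ^ 3) ->
  flow_bound G v0 l 0 -> flow_bound G v0 (e :: l) 0.
Proof.
  intros He Hx Hy Hl Hry Hrx Hsplit Hends IH m Hm.
  assert (Hxy : x <> y) by (intros ->; contradiction).
  destruct (IH (fun v => (m v + (if Nat.eqb y v then len G e + m x else 0)) +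
                         (if Nat.eqb x v then - m x else 0))) as [al [Hal Hc]].
  { intros v; generalize (Hm v) (Hm x).
    destruct (Nat.eqb_spec y v), (Nat.eqb_spec x v); subst; try contradiction; lra. }
  destruct (Hends m) as [Hv' Hs'].
  destruct (flow_cons_upd G e l al (c m) He) as [Hv Hs].
  exists (upd al e (c m)); split.
  - intros v Hv0 Hr; rewrite Hv, Hv'.
    destruct (Hsplit v Hr) as [Hr'| ->].
    + rewrite Hal by auto. ring.
    + rewrite (vdiv_unreached G v0 l) by auto.
      rewrite (proj2 (Nat.eqb_neq y x)), Nat.eqb_refl by auto; ring.
  - rewrite Hs, Hs'; clear Hs Hv Hal.
    rewrite !load_push in Hc by assumption.
    change (lsum (e :: l) (len G)) with (len G e + lsum l (len G)).
    assert (HM := rsum_ge_term (nV G) m x Hm Hx). assert (Hmx := Hm x).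
    revert Hc HM; generalize (lsum l (fun e => al e ^ 3 + (len G e - al e) ^ 3)).
    generalize (rsum (nV G) m) (lsum l (len G)); intros M S T.
    replace (M + (len G e + m x) + - m x) with (M + len G e) by ring.
    replace (S + (M + len G e)) with (len G e + S + M) by ring. intros Hc HM.
    assert ((len G e + m x) ^ 3 - m x ^ 3 <= (M + len G e) ^ 3 - M ^ 3).
    { assert (0 <= (M - m x) * len G e * (len G e + M + m x))
        by (repeat apply Rmult_le_pos; lra). nra. }
    lra.
Qed.

(** Edges that close a cycle give up their gain here; a single strict gain suffices, and
    [exists_cheap_flow] takes it from the last edge. *)
Lemma flow_bound_grown G v0 l :
  grown G v0 l -> (v0 < nV G)%nat ->
  (forall e, In e l -> (orig G e < nV G)%nat /\ (term G e < nV G)%nat /\ 0 < len G e) ->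
  flow_bound G v0 l 0.
Proof.
  induction 1 as [|e l Hg IH He Hr]; intros Hv0 Hw.
  - intros m Hm; exists (fun _ => 0); split.
    + intros v Hv [->|[e [[] _]]]; contradiction.
    + unfold lsum; simpl; lra.
  - assert (Hw' : forall e, In e l -> (orig G e < nV G)%nat /\ (term G e < nV G)%nat /\ 0 < len G e)
      by (intros; apply Hw; simpl; auto).
    specialize (IH Hv0 Hw').
    destruct (Hw e) as [Ho [Ht Hl]]; [simpl; auto|].
    destruct (classic (reach G v0 l (orig G e))) as [Hro|Hro];
    destruct (classic (reach G v0 l (term G e))) as [Hrt|Hrt].
    + intros m Hm.
      destruct (flow_bound_cycle G v0 e l) with (m := m) as [al [H1 H2]]; auto.
      { intros; apply Hw'; auto. }
      exists al; split; auto. assert (0 < len G e ^ 3) by (apply pow_lt; auto). lra.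
    + apply (flow_bound_leaf G v0 e l (term G e) (orig G e)
               (fun m => len G e + m (term G e))); auto.
      * intros v H; apply reach_cons in H; destruct H as [H|[<-|<-]]; auto.
      * intros m; split; [|ring]. intros v.
        destruct (Nat.eqb _ _), (Nat.eqb _ _); ring.
    + apply (flow_bound_leaf G v0 e l (orig G e) (term G e)
               (fun m => - m (orig G e))); auto.
      * intros v H; apply reach_cons in H; destruct H as [H|[<-|<-]]; auto.
      * intros m; split; [|ring]. intros v.
        destruct (Nat.eqb _ _), (Nat.eqb _ _); ring.
    + tauto.
Qed.

Lemma nsum_perm (l l' : list nat) (f : nat -> nat) :
  Permutation l l' -> fold_right Nat.add 0%nat (map f l) = fold_right Nat.add 0%nat (map f l').
Proof. induction 1; simpl; lia. Qed.

(** Turns an unreached end of the last edge into a vertex of degree one: neither the other edges nor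
    the half-line meet it. *)
Lemma deg_one_half_line G e l x :
  Permutation (e :: l) (seq 0 (nE G)) -> nH G = 1%nat -> x <> hvert G 0 ->
  (forall e', In e' l -> orig G e' <> x /\ term G e' <> x) ->
  (orig G e = x /\ term G e <> x) \/ (term G e = x /\ orig G e <> x) -> deg G x = 1%nat.
Proof.
  intros Hp HH Hx Hl He. unfold deg, nsum. rewrite HH; simpl.
  rewrite <- (nsum_perm _ _ _ Hp); simpl.
  rewrite (proj2 (Nat.eqb_neq (hvert G 0) x)) by auto.
  assert (H0 : fold_right Nat.add 0%nat (map (fun e => ((if Nat.eqb (orig G e) x then 1 else 0) +
      (if Nat.eqb (term G e) x then 1 else 0))%nat) l) = 0%nat).
  { clear Hp He; induction l as [|a l IH]; simpl; [reflexivity|].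
    destruct (Hl a) as [H1 H2]; [simpl; auto|].
    rewrite (proj2 (Nat.eqb_neq _ _) H1), (proj2 (Nat.eqb_neq _ _) H2).
    rewrite IH; [reflexivity|]; intros; apply Hl; simpl; auto. }
  rewrite H0.
  destruct He as [[-> H]|[-> H]]; rewrite Nat.eqb_refl, (proj2 (Nat.eqb_neq _ _) H); reflexivity.
Qed.

(** The head of a grown list has all other edges behind it. An end of it that these do not reach
    would have degree one, since the half-line sits at [hvert G 0], which always counts as reached.
    So both ends are reached and the cycle gain applies with zero loads. *)
Lemma exists_cheap_flow G :
  wf_graph G -> connected G -> no_pendant G -> nH G = 1%nat -> (0 < nE G)%nat ->
  exists al : nat -> R,
    (forall v, (v < nV G)%nat -> v <> hvert G 0 ->
       vdiv G (seq 0 (nE G)) al (fun e => len G e - al e) v = 0) /\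
    rsum (nE G) (fun e => al e ^ 3 + (len G e - al e) ^ 3) < rsum (nE G) (len G) ^ 3.
Proof.
  intros Hwf Hc Hnp HH HE. assert (Hwf' := Hwf). destruct Hwf' as [Hw Hh].
  assert (Hv0 : (hvert G 0 < nV G)%nat) by (apply Hh; lia).
  destruct (exists_grown G (hvert G 0) Hwf Hc Hv0) as [l [Hg Hp]].
  assert (Hin : forall e, In e l <-> (e < nE G)%nat).
  { intros e; split; intros He.
    - apply (Permutation_in _ Hp) in He; apply in_seq in He; lia.
    - apply (Permutation_in _ (Permutation_sym Hp)), in_seq; lia. }
  destruct Hg as [|e l Hg He Hr].
  { apply Permutation_length in Hp; rewrite length_seq in Hp; simpl in Hp; lia. }
  assert (Hwl : forall e', In e' l -> (orig G e' < nV G)%nat /\ (term G e' < nV G)%nat /\ 0 < len G e')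
    by (intros; apply Hw, Hin; simpl; auto).
  assert (Hwe : (orig G e < nV G)%nat /\ (term G e < nV G)%nat /\ 0 < len G e)
    by (apply Hw, Hin; simpl; auto).
  assert (Hnr : forall x, ~ reach G (hvert G 0) l x ->
     x <> hvert G 0 /\ forall e', In e' l -> orig G e' <> x /\ term G e' <> x).
  { intros x Hx; split; [intros ->; apply Hx; left; reflexivity|].
    intros e' He'; split; intros H; apply Hx; right; exists e'; auto. }
  assert (Hcyc : reach G (hvert G 0) l (orig G e) /\ reach G (hvert G 0) l (term G e)).
  { destruct (Hnp e) as [Hdo Hdt]; [apply Hin; simpl; auto|].
    split; apply NNPP; intros Hx; destruct (Hnr _ Hx) as [H1 H2].
    - apply Hdo, (deg_one_half_line G e l); auto. left; split; [reflexivity|].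
      intros E; rewrite E in Hr; tauto.
    - apply Hdt, (deg_one_half_line G e l); auto. right; split; [reflexivity|].
      intros E; rewrite E in Hr; tauto. }
  destruct (flow_bound_cycle G (hvert G 0) e l) with (m := fun _ : nat => 0) as [al [H1 H2]];
    try tauto; try (intros; lra).
  { intros; apply Hwl; auto. }
  { apply flow_bound_grown; auto. }
  exists al; split.
  - intros v Hv Hv'. unfold vdiv; rewrite <- (lsum_perm _ _ _ Hp).
    eapply eq_trans; [apply H1; auto|ring].
    apply connected_reach; auto. intros e' He' _; apply Hin; auto.
  - change (rsum (nE G)) with (lsum (seq 0 (nE G))).
    rewrite <- !(lsum_perm _ _ _ Hp).
    assert (H0 : rsum (nV G) (fun _ => 0) = 0) by (apply lsum_zero; auto).
    rewrite H0, Rplus_0_r in H2.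
    assert (0 < len G e ^ 3) by (apply pow_lt; tauto). lra.
Qed.

(** Weighted graph Laplacian with conductances 1 / len: minus the Kirchhoff sum of the slopes of the
    edgewise linear interpolation of [w]. *)
Definition lap (G : MGraph) (l : list nat) (w : nat -> R) : nat -> R :=
  vdiv G l (fun e => (w (orig G e) - w (term G e)) / len G e)
           (fun e => (w (term G e) - w (orig G e)) / len G e).

Lemma lap_plus_scal G l c w w' v :
  lap G l (fun u => w u + c * w' u) v = lap G l w v + c * lap G l w' v.
Proof.
  unfold lap; rewrite <- vdiv_scal, <- vdiv_plus; apply vdiv_ext.
  intros e _; unfold Rdiv; split; ring.
Qed.

(** Induction along the growth order. At a new vertex [x] the source [b x] is moved to the old end
    [y], and the potential of [x] is read off from the current [b x] that its only edge must
    carry. *)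
Lemma lap_solvable_grown G v0 l :
  grown G v0 l ->
  (forall e, In e l -> (orig G e < nV G)%nat /\ (term G e < nV G)%nat /\ 0 < len G e) ->
  forall b : nat -> R, exists w : nat -> R,
    w v0 = 0 /\ forall v, v <> v0 -> reach G v0 l v -> lap G l w v = b v.
Proof.
  induction 1 as [|e l Hg IH He Hr]; intros Hw b.
  - exists (fun _ => 0); split; [reflexivity|].
    intros v Hv [->|[e [[] _]]]; contradiction.
  - assert (Hw' : forall e, In e l -> (orig G e < nV G)%nat /\ (term G e < nV G)%nat /\ 0 < len G e)
      by (intros; apply Hw; simpl; auto).
    specialize (IH Hw').
    destruct (Hw e) as [Ho [Ht Hl]]; [simpl; auto|].
    assert (Hleaf : forall x y, reach G v0 l y -> ~ reach G v0 l x ->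
      (orig G e = x /\ term G e = y \/ orig G e = y /\ term G e = x) ->
      exists w : nat -> R, w v0 = 0 /\
        forall v, v <> v0 -> reach G v0 (e :: l) v -> lap G (e :: l) w v = b v).
    { intros x y Hy Hx Hends.
      assert (Hxy : x <> y) by (intros ->; contradiction).
      assert (Hx0 : v0 <> x) by (intros <-; apply Hx; left; reflexivity).
      destruct (IH (fun v => b v + (if Nat.eqb y v then b x else 0))) as [w [H0 H1]].
      exists (upd w x (w y + len G e * b x)); split; [rewrite upd_neq; auto|].
      intros v Hv Hrv. unfold lap at 1. rewrite vdiv_cons.
      rewrite (vdiv_ext G l _ _ (fun e => (w (orig G e) - w (term G e)) / len G e)
           (fun e => (w (term G e) - w (orig G e)) / len G e)).
      2:{ intros e' He'. rewrite !upd_neq; [auto| |]; intros E; apply Hx; right; exists e'; auto. }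
      fold (lap G l w v).
      assert (Hcontr : (if Nat.eqb (orig G e) v then
          (upd w x (w y + len G e * b x) (orig G e) - upd w x (w y + len G e * b x) (term G e)) / len G e else 0) +
        (if Nat.eqb (term G e) v then
          (upd w x (w y + len G e * b x) (term G e) - upd w x (w y + len G e * b x) (orig G e)) / len G e else 0)
        = (if Nat.eqb x v then b x else 0) + (if Nat.eqb y v then - b x else 0)).
      { destruct Hends as [[-> ->]|[-> ->]]; rewrite upd_eq, upd_neq by auto;
          destruct (Nat.eqb _ _), (Nat.eqb _ _); field; lra. }
      rewrite Hcontr.
      apply reach_cons in Hrv.
      destruct (classic (reach G v0 l v)) as [Hv'|Hv'].
      - rewrite H1 by auto. rewrite (proj2 (Nat.eqb_neq x v)) by (intros ->; contradiction).
        destruct (Nat.eqb y v); ring.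
      - assert (v = x) as ->.
        { destruct Hrv as [Hrv|[<-|<-]]; [contradiction| |];
            destruct Hends as [[E1 E2]|[E1 E2]]; try congruence;
            exfalso; apply Hv'; congruence. }
        unfold lap; rewrite (vdiv_unreached G v0) by auto.
        rewrite Nat.eqb_refl, (proj2 (Nat.eqb_neq y x)) by auto; ring. }
    destruct (classic (reach G v0 l (orig G e))) as [Hro|Hro];
    destruct (classic (reach G v0 l (term G e))) as [Hrt|Hrt]; [|eauto|eauto|tauto].
    (* Closing a cycle is a rank-one update of the Laplacian. *)
    set (d := fun v => (if Nat.eqb (orig G e) v then 1 else 0) - (if Nat.eqb (term G e) v then 1 else 0)).
    destruct (IH b) as [w [Hw0 Hw1]]. destruct (IH d) as [z [Hz0 Hz1]].
    (* This difference is the effective resistance of [l] between the ends of [e]. It equals the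
       Dirichlet energy of [z], so the denominator of [t] below is at least [len G e]. *)
    assert (Hz : 0 <= z (orig G e) - z (term G e)).
    { replace (z (orig G e) - z (term G e)) with
        (lsum l (fun e => z (orig G e) * ((z (orig G e) - z (term G e)) / len G e) +
                          z (term G e) * ((z (term G e) - z (orig G e)) / len G e))).
      - apply lsum_nonneg; intros e' He'. destruct (Hw' e' He') as [_ [_ Hl']].
        replace (z (orig G e') * ((z (orig G e') - z (term G e')) / len G e') +
                 z (term G e') * ((z (term G e') - z (orig G e')) / len G e'))
          with ((z (orig G e') - z (term G e')) ^ 2 / len G e') by (field; lra).
        apply Rmult_le_pos; [apply pow2_ge_0|left; apply Rinv_0_lt_compat; auto].
      - rewrite (vdiv_by_parts G l z) by (intros e' He'; destruct (Hw' e' He') as [? [? _]]; auto).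
        change (rsum (nV G)) with (lsum (seq 0 (nV G))).
        rewrite (lsum_ext _ _ (fun v => (if Nat.eqb (orig G e) v then z v else 0) +
                                 (-1) * (if Nat.eqb (term G e) v then z v else 0))).
        + rewrite lsum_plus, lsum_scal.
          change (lsum (seq 0 (nV G))) with (rsum (nV G)).
          rewrite !rsum_indicator by assumption. ring.
        + intros v _. fold (lap G l z v).
          destruct (Nat.eq_dec v v0) as [->|Hv0].
          * rewrite Hz0. destruct (Nat.eqb _ _), (Nat.eqb _ _); ring.
          * destruct (classic (reach G v0 l v)) as [Hv|Hv].
            -- rewrite Hz1 by auto. unfold d. destruct (Nat.eqb _ _), (Nat.eqb _ _); ring.
            -- unfold lap; rewrite (vdiv_unreached G v0) by auto.
               rewrite (proj2 (Nat.eqb_neq (orig G e) v)), (proj2 (Nat.eqb_neq (term G e) v))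
                 by (intros <-; contradiction). ring. }
    (* Current through the new edge: it solves the requirement that the potential drop of w - t z
       across [e] be [t * len G e]. *)
    set (t := (w (orig G e) - w (term G e)) / (len G e + (z (orig G e) - z (term G e)))).
    exists (fun v => w v + (- t) * z v); split; [rewrite Hw0, Hz0; ring|].
    intros v Hv Hrv. apply reach_cons in Hrv.
    assert (Hrv' : reach G v0 l v) by (destruct Hrv as [Hrv|[<-|<-]]; auto).
    unfold lap; rewrite vdiv_cons; fold (lap G l (fun v => w v + (- t) * z v) v).
    rewrite lap_plus_scal, Hw1, Hz1 by auto. unfold d, t.
    destruct (Nat.eqb _ _), (Nat.eqb _ _); field; lra.
Qed.

(** Potentials of unit sources, superposed. The linear dependence on [b] makes [nod] and [gop]
    linear in their data, which the contraction estimate needs. *)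
Lemma exists_discrete_green G :
  wf_graph G -> connected G -> (hvert G 0 < nV G)%nat ->
  exists gam : nat -> nat -> R,
    (forall u, gam u (hvert G 0) = 0) /\
    forall (b : nat -> R) v, (v < nV G)%nat -> v <> hvert G 0 ->
      lap G (seq 0 (nE G)) (fun x => rsum (nV G) (fun u => b u * gam u x)) v = b v.
Proof.
  intros Hwf Hc Hv0.
  destruct (exists_grown G (hvert G 0) Hwf Hc Hv0) as [l [Hg Hp]].
  assert (Hin : forall e, In e l <-> (e < nE G)%nat).
  { intros e; split; intros He.
    - apply (Permutation_in _ Hp) in He; apply in_seq in He; lia.
    - apply (Permutation_in _ (Permutation_sym Hp)), in_seq; lia. }
  destruct Hwf as [Hw _].
  assert (H : forall u, exists w : nat -> R, w (hvert G 0) = 0 /\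
     forall v, (v < nV G)%nat -> v <> hvert G 0 ->
       lap G (seq 0 (nE G)) w v = if Nat.eqb u v then 1 else 0).
  { intros u. destruct (lap_solvable_grown G (hvert G 0) l Hg) with
      (b := fun v => if Nat.eqb u v then 1 else 0) as [w [H0 H1]].
    { intros; apply Hw, Hin; auto. }
    exists w; split; auto. intros v Hv Hv'. rewrite <- H1; auto.
    - unfold lap, vdiv; symmetry; apply lsum_perm; auto.
    - apply connected_reach; auto. intros e' He' _; apply Hin; auto. }
  destruct (functional_choice _ H) as [gam Hg'].
  exists gam; split; [intros u; apply Hg'|].
  intros b v Hv Hv'.
  assert (Hgam : forall u, lap G (seq 0 (nE G)) (gam u) v = if Nat.eqb u v then 1 else 0)
    by (intros u; apply Hg'; auto).
  assert (Hlin : forall us, lap G (seq 0 (nE G)) (fun x => lsum us (fun u => b u * gam u x)) v =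
     lsum us (fun u => b u * (if Nat.eqb u v then 1 else 0))).
  { induction us as [|u us IH].
    - apply lsum_zero; intros e _; change (lsum nil _) with 0.
      unfold Rdiv; rewrite Rminus_diag, Rmult_0_l; destruct (Nat.eqb _ _), (Nat.eqb _ _); ring.
    - change (lsum (u :: us) ?f) with (f u + lsum us f); cbv beta.
      rewrite <- IH, <- Hgam, Rplus_comm, <- lap_plus_scal.
      apply vdiv_ext. intros e _; change (lsum (u :: us) ?f) with (f u + lsum us f); cbv beta.
      split; f_equal; ring. }
  change (lap G (seq 0 (nE G)) (fun x => lsum (seq 0 (nV G)) (fun u => b u * gam u x)) v = b v).
  rewrite Hlin, <- (rsum_indicator (nV G) v b Hv).
  apply lsum_ext; intros u _; rewrite Nat.eqb_sym; destruct (Nat.eqb v u); ring.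
Qed.

(** * Fixed points and the Green operator of the core *)

Definition unif_dist_le (x y : nat -> R -> R) (c : R) : Prop :=
  forall i t, Rabs (x i t - y i t) <= c.

(** Banach's theorem with ratio 1/2 for the uniform distance over all indices and all real
    arguments. Completeness is obtained pointwise, and [S] has to be closed under uniform limits;
    [B] bounds the first step. *)
Lemma contraction_fixed_point (S : (nat -> R -> R) -> Prop)
    (T : (nat -> R -> R) -> nat -> R -> R) (x0 : nat -> R -> R) (B : R) :
  S x0 -> (forall x, S x -> S (T x)) ->
  (forall u l, (forall n : nat, S (u n)) ->
     (forall eps, 0 < eps -> exists n, unif_dist_le (u n) l eps) -> S l) ->
  (forall x y c, 0 <= c -> S x -> S y -> unif_dist_le x y c -> unif_dist_le (T x) (T y) (c / 2)) ->
  unif_dist_le x0 (T x0) B ->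
  exists x, S x /\ forall i t, T x i t = x i t.
Proof.
  intros H0 HT Hcl Hc HB.
  assert (HB0 : 0 <= B) by (eapply Rle_trans; [apply Rabs_pos|apply (HB 0%nat 0)]).
  pose (u := fix u n := match n with O => x0 | Datatypes.S n => T (u n) end).
  assert (HS : forall n, S (u n)) by (induction n; simpl; auto).
  assert (Hstep : forall n, unif_dist_le (u n) (u (Datatypes.S n)) (B * (/ 2) ^ n)).
  { induction n as [|n IH]; [simpl; rewrite Rmult_1_r; exact HB|].
    replace (B * (/ 2) ^ Datatypes.S n) with (B * (/ 2) ^ n / 2) by (simpl; field).
    apply Hc; auto. apply Rmult_le_pos; [lra|apply pow_le; lra]. }
  (* The factor 1 - 2^(-k) records the partial geometric sum exactly, so that the induction on [k]
     closes. *)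
  assert (Hgeo : forall n k, unif_dist_le (u n) (u (n + k)%nat) (2 * B * (/ 2) ^ n * (1 - (/ 2) ^ k))).
  { intros n k i t; induction k as [|k IH].
    - rewrite Nat.add_0_r; simpl; rewrite Rminus_diag, Rabs_R0, Rminus_diag; lra.
    - rewrite Nat.add_succ_r.
      generalize (Hstep (n + k)%nat i t). rewrite pow_add.
      replace (u n i t - u (Datatypes.S (n + k)) i t) with
        ((u n i t - u (n + k)%nat i t) + (u (n + k)%nat i t - u (Datatypes.S (n + k)) i t)) by ring.
      intros H; eapply Rle_trans; [apply Rabs_triang|].
      replace (2 * B * (/ 2) ^ n * (1 - (/ 2) ^ Datatypes.S k)) with
        (2 * B * (/ 2) ^ n * (1 - (/ 2) ^ k) + B * ((/ 2) ^ n * (/ 2) ^ k)) by (simpl; field).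
      lra. }
  assert (Hdist : forall n k, unif_dist_le (u n) (u (n + k)%nat) (2 * B * (/ 2) ^ n)).
  { intros n k i t; eapply Rle_trans; [apply Hgeo|].
    assert (0 <= (/ 2) ^ k) by (apply pow_le; lra).
    assert (0 <= 2 * B * (/ 2) ^ n) by (apply Rmult_le_pos; [lra|apply pow_le; lra]). nra. }
  assert (Hsmall : forall eps, 0 < eps -> exists n, 2 * B * (/ 2) ^ n < eps).
  { intros eps He.
    assert (Hl : is_lim_seq (fun n => 2 * B * (/ 2) ^ n) 0).
    { replace (Finite 0) with (Rbar_mult (2 * B) 0) by (simpl; f_equal; ring).
      apply is_lim_seq_scal_l, is_lim_seq_geom. rewrite Rabs_pos_eq; lra. }
    apply is_lim_seq_spec in Hl. destruct (Hl (mkposreal eps He)) as [N HN].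
    exists N. specialize (HN N (Nat.le_refl N)). rewrite Rminus_0_r in HN.
    eapply Rle_lt_trans; [apply Rle_abs|exact HN]. }
  assert (Hlim : forall i t, ex_finite_lim_seq (fun n => u n i t)).
  { intros i t; apply ex_lim_seq_cauchy_corr. intros eps.
    destruct (Hsmall (eps / 2)) as [N HN]; [destruct eps; simpl; lra|].
    exists N; intros n m Hn Hm.
    assert (H1 := Hdist N (n - N)%nat i t). assert (H2 := Hdist N (m - N)%nat i t).
    replace (N + (n - N))%nat with n in H1 by lia. replace (N + (m - N))%nat with m in H2 by lia.
    replace (u n i t - u m i t) with (- (u N i t - u n i t) + (u N i t - u m i t)) by ring.
    eapply Rle_lt_trans; [apply Rabs_triang|]. rewrite Rabs_Ropp. lra. }
  set (l := fun i t => real (Lim_seq (fun n => u n i t))).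
  assert (Hl : forall n, unif_dist_le (u n) l (2 * B * (/ 2) ^ n)).
  { intros n i t.
    assert (H : is_lim_seq (fun k => Rabs (u n i t - u (k + n)%nat i t)) (Rabs (u n i t - l i t))).
    { apply (is_lim_seq_abs _ (Finite (u n i t - l i t))).
      apply is_lim_seq_minus'; [apply is_lim_seq_const|].
      apply (is_lim_seq_incr_n (fun k => u k i t)), Lim_seq_correct', Hlim. }
    apply (is_lim_seq_le (fun k => Rabs (u n i t - u (k + n)%nat i t)) (fun _ => 2 * B * (/ 2) ^ n)
             (Finite (Rabs (u n i t - l i t))) (Finite (2 * B * (/ 2) ^ n)));
      [|exact H|apply is_lim_seq_const].
    intros k; rewrite Nat.add_comm; apply Hdist. }
  assert (HSl : S l).
  { apply (Hcl u); auto. intros eps He; destruct (Hsmall eps He) as [n Hn].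
    exists n; intros i t; eapply Rle_trans; [apply Hl|lra]. }
  exists l; split; auto. intros i t.
  apply Rminus_diag_uniq, cond_eq. intros eps He.
  destruct (Hsmall (eps / 2)) as [n Hn]; [lra|].
  assert (Hp : 0 <= 2 * B * (/ 2) ^ n) by (apply Rmult_le_pos; [lra|apply pow_le; lra]).
  assert (H1 := Hc (u n) l _ Hp (HS n) HSl (Hl n) i t).
  assert (H2 := Hl (Datatypes.S n) i t). change (u (Datatypes.S n)) with (T (u n)) in H2.
  replace (2 * B * (/ 2) ^ Datatypes.S n) with (2 * B * (/ 2) ^ n / 2) in H2 by (simpl; field).
  replace (T l i t - l i t - 0) with (- (T (u n) i t - T l i t) + (T (u n) i t - l i t)) by ring.
  eapply Rle_lt_trans; [apply Rabs_triang|]. rewrite Rabs_Ropp. lra.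
Qed.

Lemma unif_limit_continuous (u : nat -> nat -> R -> R) l i x :
  (forall n t, continuous (u n i) t) ->
  (forall eps, 0 < eps -> exists n, unif_dist_le (u n) l eps) -> continuous (l i) x.
Proof.
  intros Hu Hl. apply continuity_pt_filterlim. intros eps He.
  destruct (Hl (eps / 3)) as [n Hn]; [lra|].
  assert (Hc := Hu n x). apply continuity_pt_filterlim in Hc.
  destruct (Hc (eps / 3)) as [d [Hd H]]; [lra|].
  exists d; split; auto. intros y Hy. specialize (H y Hy).
  change (Rabs (u n i y - u n i x) < eps / 3) in H. change (Rabs (l i y - l i x) < eps).
  assert (H1 := Hn i y). assert (H2 := Hn i x).
  replace (l i y - l i x) with (- (u n i y - l i y) + ((u n i y - u n i x) + (u n i x - l i x))) by ring.
  eapply Rle_lt_trans; [apply Rabs_triang|]. rewrite Rabs_Ropp.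
  assert (H3 := Rabs_triang (u n i y - u n i x) (u n i x - l i x)). lra.
Qed.

(** * The explicit Green operator with Dirichlet condition at the half-line vertex *)

Lemma is_derive_continuous (f : R -> R) x l : is_derive f x l -> continuous f x.
Proof. intros H; apply (ex_derive_continuous f); exists l; exact H. Qed.

Lemma ex_RInt_cont (f : R -> R) a b : (forall x, continuous f x) -> ex_RInt f a b.
Proof. intros H; apply (ex_RInt_continuous f); auto. Qed.

Lemma is_derive_RInt_cont (f : R -> R) x :
  (forall x, continuous f x) -> is_derive (fun x => RInt f 0 x) x (f x).
Proof.
  intros H; apply (is_derive_RInt f (fun x => RInt f 0 x) 0 x); auto.
  apply filter_forall; intros y; apply (RInt_correct f), ex_RInt_cont, H.
Qed.

Lemma continuous_RInt_cont (f : R -> R) x :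
  (forall x, continuous f x) -> continuous (fun x => RInt f 0 x) x.
Proof. intros H; eapply is_derive_continuous, is_derive_RInt_cont, H. Qed.

(* [w = gop G gam g] solves [- w'' = g] on each edge, with Kirchhoff's rule at all
   vertices except [hvert G 0], where it vanishes; [nod] are its vertex values and
   [gam] is the Green function of the discrete Laplacian [lap]. *)
Definition int1 (g : nat -> R -> R) e x := RInt (g e) 0 x.
Definition int2 (g : nat -> R -> R) e x := RInt (int1 g e) 0 x.

Definition nod (G : MGraph) (gam : nat -> nat -> R) (g : nat -> R -> R) (v : nat) : R :=
  rsum (nV G) (fun u => vdiv G (seq 0 (nE G)) (fun e => int2 g e (len G e) / len G e)
     (fun e => int1 g e (len G e) - int2 g e (len G e) / len G e) u * gam u v).

Definition dgop0 G gam g e : R :=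
  (nod G gam g (term G e) - nod G gam g (orig G e)) / len G e + int2 g e (len G e) / len G e.

Definition gop G gam g e x : R := nod G gam g (orig G e) + dgop0 G gam g e * x - int2 g e x.

Definition dgop G gam g e x : R := dgop0 G gam g e - int1 g e x.

Definition is_green (G : MGraph) (gam : nat -> nat -> R) : Prop :=
  (forall u, gam u (hvert G 0) = 0) /\
  forall (b : nat -> R) v, (v < nV G)%nat -> v <> hvert G 0 ->
    lap G (seq 0 (nE G)) (fun x => rsum (nV G) (fun u => b u * gam u x)) v = b v.

Lemma int1_continuous g e x : (forall t, continuous (g e) t) -> continuous (int1 g e) x.
Proof. apply continuous_RInt_cont. Qed.

Lemma is_derive_gop G gam g e x :
  (forall t, continuous (g e) t) -> is_derive (gop G gam g e) x (dgop G gam g e x).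
Proof.
  intros Hg. unfold gop, dgop.
  apply (is_derive_minus (fun x => nod G gam g (orig G e) + dgop0 G gam g e * x) (int2 g e)).
  - auto_derive; [auto|ring].
  - apply is_derive_RInt_cont. intros t; apply int1_continuous, Hg.
Qed.

Lemma is_derive_dgop G gam g e x :
  (forall t, continuous (g e) t) -> is_derive (dgop G gam g e) x (- g e x).
Proof.
  intros Hg. unfold dgop. replace (- g e x) with (0 - g e x) by ring.
  apply (is_derive_minus (fun x => dgop0 G gam g e) (int1 g e)).
  - apply @is_derive_const.
  - apply is_derive_RInt_cont, Hg.
Qed.

Lemma gop_orig G gam g e : gop G gam g e 0 = nod G gam g (orig G e).
Proof. unfold gop, int2; rewrite RInt_point; change zero with 0; ring. Qed.

Lemma gop_term G gam g e : 0 < len G e -> gop G gam g e (len G e) = nod G gam g (term G e).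
Proof. intros H; unfold gop, dgop0; field; lra. Qed.

Lemma dgop_orig G gam g e : dgop G gam g e 0 = dgop0 G gam g e.
Proof. unfold dgop, int1; rewrite RInt_point; change zero with 0; ring. Qed.

Lemma nod_root G gam g : is_green G gam -> nod G gam g (hvert G 0) = 0.
Proof. intros [H _]; apply lsum_zero; intros u _; rewrite H; ring. Qed.

Lemma gop_kirchhoff G gam g v :
  is_green G gam -> (v < nV G)%nat -> v <> hvert G 0 ->
  vdiv G (seq 0 (nE G)) (fun e => dgop G gam g e 0) (fun e => - dgop G gam g e (len G e)) v = 0.
Proof.
  intros [_ Hgam] Hv Hv'.
  set (b := vdiv G (seq 0 (nE G)) (fun e => int2 g e (len G e) / len G e)
     (fun e => int1 g e (len G e) - int2 g e (len G e) / len G e)).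
  specialize (Hgam b v Hv Hv').
  change (lap G (seq 0 (nE G)) (nod G gam g) v = b v) in Hgam.
  transitivity (b v + (-1) * lap G (seq 0 (nE G)) (nod G gam g) v); [|rewrite Hgam; ring].
  unfold b, lap. rewrite <- vdiv_scal, <- vdiv_plus. apply vdiv_ext; intros e _.
  rewrite dgop_orig; unfold dgop, dgop0, Rdiv; split; ring.
Qed.

Lemma int1_minus g1 g2 e x :
  (forall t, continuous (g1 e) t) -> (forall t, continuous (g2 e) t) ->
  int1 (fun e t => g1 e t - g2 e t) e x = int1 g1 e x - int1 g2 e x.
Proof.
  intros H1 H2. apply (RInt_minus (g1 e) (g2 e)); apply ex_RInt_cont; auto.
Qed.

Lemma int2_minus g1 g2 e x :
  (forall t, continuous (g1 e) t) -> (forall t, continuous (g2 e) t) ->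
  int2 (fun e t => g1 e t - g2 e t) e x = int2 g1 e x - int2 g2 e x.
Proof.
  intros H1 H2. unfold int2. erewrite RInt_ext; [|intros t _; apply int1_minus; auto].
  apply (RInt_minus (int1 g1 e) (int1 g2 e)); apply ex_RInt_cont; intros; apply int1_continuous; auto.
Qed.

Lemma gop_minus G gam g1 g2 e x :
  (forall e t, continuous (g1 e) t) -> (forall e t, continuous (g2 e) t) ->
  gop G gam (fun e t => g1 e t - g2 e t) e x = gop G gam g1 e x - gop G gam g2 e x.
Proof.
  intros H1 H2.
  assert (Hn : forall v, nod G gam (fun e t => g1 e t - g2 e t) v = nod G gam g1 v - nod G gam g2 v).
  { intros v. replace (nod G gam g1 v - nod G gam g2 v) with (nod G gam g1 v + (-1) * nod G gam g2 v) by ring.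
    unfold nod; change (rsum (nV G)) with (lsum (seq 0 (nV G))).
    rewrite <- lsum_scal, <- lsum_plus; apply lsum_ext; intros u _.
    rewrite <- Rmult_assoc, <- Rmult_plus_distr_r; f_equal.
    rewrite <- vdiv_scal, <- vdiv_plus; apply vdiv_ext; intros e' _.
    rewrite int1_minus, !int2_minus by auto; unfold Rdiv; split; ring. }
  unfold gop, dgop0; rewrite !Hn, !int2_minus by auto; unfold Rdiv; ring.
Qed.

Lemma RInt_abs_le (f : R -> R) a b c :
  a <= b -> (forall x, continuous f x) -> (forall t, a <= t <= b -> Rabs (f t) <= c) ->
  Rabs (RInt f a b) <= (b - a) * c.
Proof. intros Hab Hf H; apply abs_RInt_le_const; auto; apply ex_RInt_cont, Hf. Qed.

(** The constant depends on the graph and on [gam] only; this is the source of all uniformity in p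
    and kap. *)
Lemma gop_bound G gam :
  wf_graph G -> exists C, 0 < C /\ forall g c, 0 <= c ->
    (forall e t, continuous (g e) t) ->
    (forall e x, (e < nE G)%nat -> 0 <= x <= len G e -> Rabs (g e x) <= c) ->
    forall e x, (e < nE G)%nat -> 0 <= x <= len G e -> Rabs (gop G gam g e x) <= C * c.
Proof.
  intros [Hw _].
  set (K := rsum (nE G) (len G)). set (N := rsum (nE G) (fun _ => 1)).
  set (Ga := rsum (nV G) (fun v => rsum (nV G) (fun u => Rabs (gam u v)))).
  assert (HK : 0 <= K) by (apply lsum_nonneg; intros e He; apply in_seq in He; left; apply Hw; lia).
  assert (HN : 0 <= N) by (apply lsum_nonneg; intros; lra).
  assert (Hrow : forall v, 0 <= rsum (nV G) (fun u => Rabs (gam u v)))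
    by (intros v; apply lsum_nonneg; intros; apply Rabs_pos).
  assert (HGa : 0 <= Ga) by (apply lsum_nonneg; auto).
  (* Each edge feeds at most K c + 2 K c into a vertex sum, so vertex values are at most M = 3 N K
     Ga c. The linear part costs M + 2 M, the remainder on the edge 2 K^2 c, and the final 1 makes
     the constant positive. *)
  exists (9 * N * K * Ga + 2 * K * K + 1); split.
  { assert (0 <= 9 * N * K * Ga) by (repeat apply Rmult_le_pos; lra). nra. }
  intros g c Hc Hg Hgc.
  assert (HeK : forall e, (e < nE G)%nat -> len G e <= K).
  { intros e He. unfold K. rewrite <- (rsum_indicator (nE G) e (len G) He).
    apply lsum_le; intros e' He'; apply in_seq in He'.
    destruct (Nat.eqb e e'); [lra|left; apply Hw; lia]. }
  assert (H1 : forall e x, (e < nE G)%nat -> 0 <= x <= len G e -> Rabs (int1 g e x) <= K * c).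
  { intros e x He Hx. eapply Rle_trans; [apply RInt_abs_le with (c := c); [lra|auto|]|].
    - intros t Ht; apply Hgc; auto; lra.
    - apply Rmult_le_compat_r; [lra|]. specialize (HeK e He); lra. }
  assert (H2 : forall e x, (e < nE G)%nat -> 0 <= x <= len G e -> Rabs (int2 g e x) <= x * (K * c)).
  { intros e x He Hx. eapply Rle_trans; [apply RInt_abs_le with (c := K * c); [lra|intros; apply int1_continuous; auto|]|].
    - intros t Ht; apply H1; auto; lra.
    - lra. }
  assert (H2' : forall e, (e < nE G)%nat -> Rabs (int2 g e (len G e) / len G e) <= K * c).
  { intros e He. destruct (Hw e He) as [_ [_ Hl]].
    unfold Rdiv; rewrite Rabs_mult, Rabs_inv, (Rabs_pos_eq (len G e)) by lra.
    apply Rmult_le_reg_r with (len G e); auto.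
    rewrite Rmult_assoc, Rinv_l, Rmult_1_r by lra.
    generalize (H2 e (len G e) He); lra. }
  assert (Hnod : forall v, (v < nV G)%nat -> Rabs (nod G gam g v) <= 3 * N * K * Ga * c).
  { intros v Hv. unfold nod. eapply Rle_trans; [apply lsum_abs|].
    apply Rle_trans with (lsum (seq 0 (nV G)) (fun u => (3 * K * c * N) * Rabs (gam u v))).
    - apply lsum_le; intros u _. rewrite Rabs_mult; apply Rmult_le_compat_r; [apply Rabs_pos|].
      unfold vdiv; eapply Rle_trans; [apply lsum_abs|].
      unfold N; change (rsum (nE G)) with (lsum (seq 0 (nE G))).
      rewrite <- lsum_scal; apply lsum_le; intros e He; apply in_seq in He.
      assert (He' : (e < nE G)%nat) by lia.
      assert (Ha := H2' e He'). assert (Hb := H1 e (len G e) He').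
      destruct (Hw e He') as [_ [_ Hl]].
      assert (Hb' : Rabs (int1 g e (len G e) - int2 g e (len G e) / len G e) <= 2 * K * c).
      { eapply Rle_trans; [apply Rabs_triang|]. rewrite Rabs_Ropp.
        specialize (Hb ltac:(lra)). lra. }
      assert (0 <= K * c) by (apply Rmult_le_pos; lra).
      eapply Rle_trans; [apply Rabs_triang|].
      destruct (Nat.eqb _ _), (Nat.eqb _ _); rewrite ?Rabs_R0; lra.
    - rewrite lsum_scal.
      assert (Hr := rsum_ge_term (nV G) (fun v => rsum (nV G) (fun u => Rabs (gam u v))) v Hrow Hv).
      cbv beta in Hr. fold Ga in Hr.
      change (lsum (seq 0 (nV G))) with (rsum (nV G)).
      replace (3 * N * K * Ga * c) with (3 * K * c * N * Ga) by ring.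
      apply Rmult_le_compat_l; auto. repeat apply Rmult_le_pos; lra. }
  intros e x He Hx. destruct (Hw e He) as [Ho [Ht Hl]].
  assert (Hno := Hnod _ Ho). assert (Hnt := Hnod _ Ht).
  assert (Hfrac : 0 <= x / len G e <= 1).
  { split; [apply Rmult_le_pos; [lra|left; apply Rinv_0_lt_compat; lra]|].
    apply Rmult_le_reg_r with (len G e); auto. unfold Rdiv; rewrite Rmult_assoc, Rinv_l; lra. }
  unfold gop, dgop0.
  replace (nod G gam g (orig G e) +
    ((nod G gam g (term G e) - nod G gam g (orig G e)) / len G e + int2 g e (len G e) / len G e) * x -
    int2 g e x) with
   (nod G gam g (orig G e) + ((nod G gam g (term G e) - nod G gam g (orig G e)) * (x / len G e) +
    (int2 g e (len G e) / len G e * x - int2 g e x))) by (field; lra).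
  set (M := 3 * N * K * Ga * c) in *.
  assert (HM : 0 <= M) by (eapply Rle_trans; [apply Rabs_pos|exact Hno]).
  assert (Hx2 := H2 e x He Hx). assert (Hs := H2' e He). assert (HeK' := HeK e He).
  assert (Hp1 : Rabs ((nod G gam g (term G e) - nod G gam g (orig G e)) * (x / len G e)) <= 2 * M).
  { rewrite Rabs_mult, (Rabs_pos_eq (x / len G e)) by lra.
    apply Rle_trans with (2 * M * 1); [|lra].
    apply Rmult_le_compat; try apply Rabs_pos; try lra.
    eapply Rle_trans; [apply Rabs_triang|]. rewrite Rabs_Ropp; lra. }
  assert (Hkc : 0 <= K * c) by (apply Rmult_le_pos; lra).
  assert (Hp2 : Rabs (int2 g e (len G e) / len G e * x - int2 g e x) <= 2 * K * K * c).
  { eapply Rle_trans; [apply Rabs_triang|]. rewrite Rabs_Ropp, Rabs_mult, (Rabs_pos_eq x) by lra.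
    assert (Rabs (int2 g e (len G e) / len G e) * x <= K * c * K)
      by (apply Rmult_le_compat; try apply Rabs_pos; lra).
    assert (x * (K * c) <= K * (K * c)) by (apply Rmult_le_compat_r; lra). lra. }
  eapply Rle_trans; [apply Rabs_triang|].
  assert (H3 := Rabs_triang ((nod G gam g (term G e) - nod G gam g (orig G e)) * (x / len G e))
     (int2 g e (len G e) / len G e * x - int2 g e x)).
  replace ((9 * N * K * Ga + 2 * K * K + 1) * c) with (3 * M + 2 * K * K * c + c) by (unfold M; ring).
  lra.
Qed.

(** At every vertex one factor vanishes: [phi] at the half-line vertex, the Kirchhoff sum elsewhere.
    This removes all boundary terms when testing with [gop]. *)
Lemma lsum_split_end G (phi a b : nat -> R) :
  wf_graph G -> phi (hvert G 0) = 0 ->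
  (forall v, (v < nV G)%nat -> v <> hvert G 0 -> vdiv G (seq 0 (nE G)) a b v = 0) ->
  lsum (seq 0 (nE G)) (fun e => phi (orig G e) * a e + phi (term G e) * b e) = 0.
Proof.
  intros [Hw _] H0 Hv.
  rewrite vdiv_by_parts by (intros e He; apply in_seq in He; split; apply Hw; lia).
  apply lsum_zero; intros v Hin; apply in_seq in Hin.
  destruct (Nat.eq_dec v (hvert G 0)) as [->|Hne]; [rewrite H0; ring|].
  rewrite Hv by (auto; lia); ring.
Qed.

Lemma is_RInt_poly2 a l : is_RInt (fun x => (a - x) ^ 2) 0 l ((a ^ 3 + (l - a) ^ 3) / 3).
Proof.
  replace ((a ^ 3 + (l - a) ^ 3) / 3) with (minus (- (a - l) ^ 3 / 3) (- (a - 0) ^ 3 / 3))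
    by (unfold minus, plus, opp; simpl; field).
  apply (is_RInt_derive (fun x => - (a - x) ^ 3 / 3)).
  - intros x _; auto_derive; [auto|field].
  - intros x _. apply (is_derive_continuous _ x (- 2 * (a - x))). auto_derive; [auto|ring].
Qed.

(** * Energy of the Green operator *)

Lemma RInt_minus_R (f g : R -> R) a b :
  (forall x, continuous f x) -> (forall x, continuous g x) ->
  RInt (fun x => f x - g x) a b = RInt f a b - RInt g a b.
Proof. intros; apply (RInt_minus f g); apply ex_RInt_cont; auto. Qed.

Lemma RInt_plus_R (f g : R -> R) a b :
  (forall x, continuous f x) -> (forall x, continuous g x) ->
  RInt (fun x => f x + g x) a b = RInt f a b + RInt g a b.
Proof. intros; apply (RInt_plus f g); apply ex_RInt_cont; auto. Qed.

Lemma RInt_scal_R (f : R -> R) k a b :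
  (forall x, continuous f x) -> RInt (fun x => k * f x) a b = k * RInt f a b.
Proof. intros; apply (RInt_scal f); apply ex_RInt_cont; auto. Qed.

Lemma continuous_scal_R (f : R -> R) k x :
  continuous f x -> continuous (fun x => k * f x) x.
Proof. intros; apply (continuous_scal_r k f); auto. Qed.

Lemma continuous_plus_R (f g : R -> R) x :
  continuous f x -> continuous g x -> continuous (fun x => f x + g x) x.
Proof. apply (continuous_plus f g). Qed.

Lemma continuous_minus_R (f g : R -> R) x :
  continuous f x -> continuous g x -> continuous (fun x => f x - g x) x.
Proof. apply (continuous_minus f g). Qed.

Lemma continuous_mult_R (f g : R -> R) x :
  continuous f x -> continuous g x -> continuous (fun x => f x * g x) x.
Proof. apply (continuous_mult f g). Qed.

Lemma continuous_sq (f : R -> R) x : continuous f x -> continuous (fun x => f x ^ 2) x.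
Proof.
  intros H; apply (continuous_ext (fun x => f x * f x)); [|apply continuous_mult_R; auto].
  intros y; assert (E : f y * f y = f y ^ 2) by ring; exact E.
Qed.

Lemma is_derive_mult_R (f g : R -> R) x df dg :
  is_derive f x df -> is_derive g x dg -> is_derive (fun x => f x * g x) x (df * g x + f x * dg).
Proof. intros Hf Hg; apply (is_derive_mult f g); auto. intros; apply Rmult_comm. Qed.

Lemma is_RInt_derive_cont (f df : R -> R) a b :
  (forall x, is_derive f x (df x)) -> (forall x, continuous df x) ->
  RInt df a b = f b - f a.
Proof.
  intros H1 H2; apply is_RInt_unique, (is_RInt_derive f df); auto.
Qed.

Lemma is_derive_ext_l_eq (f : R -> R) x (l l' : R) : is_derive f x l -> l = l' -> is_derive f x l'.
Proof. intros H <-; exact H. Qed.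

Lemma edge_by_parts (z dz rho : R -> R) l :
  (forall x, is_derive z x (dz x)) -> (forall x, is_derive dz x (- rho x)) ->
  (forall x, continuous rho x) ->
  RInt (fun x => dz x ^ 2) 0 l = RInt (fun x => rho x * z x) 0 l + (z l * dz l - z 0 * dz 0).
Proof.
  intros Hz Hdz Hr.
  assert (Cz : forall x, continuous z x) by (intros x; eapply is_derive_continuous, Hz).
  assert (Cdz : forall x, continuous dz x) by (intros x; eapply is_derive_continuous, Hdz).
  assert (C1 : forall x, continuous (fun x => dz x ^ 2) x) by (intros; apply continuous_sq; auto).
  assert (C2 : forall x, continuous (fun x => rho x * z x) x)
    by (intros; apply continuous_mult_R; auto).
  assert (H : RInt (fun x => dz x ^ 2 - rho x * z x) 0 l = z l * dz l - z 0 * dz 0).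
  { apply (is_RInt_derive_cont (fun x => z x * dz x)).
    - intros x. eapply is_derive_ext_l_eq; [apply is_derive_mult_R; auto|ring].
    - intros x; apply continuous_minus_R; auto. }
  rewrite RInt_minus_R in H by auto. lra.
Qed.

(* The flow [al - x] has the constant divergence 1; Young's inequality
   [r z' q <= z'^2 / 2 + r^2 q^2 / 2]. *)
Lemma edge_flow_le (z dz : R -> R) l al r :
  0 <= l -> (forall x, is_derive z x (dz x)) -> (forall x, continuous dz x) ->
  r * RInt z 0 l <= / 2 * RInt (fun x => dz x ^ 2) 0 l + r ^ 2 / 6 * (al ^ 3 + (l - al) ^ 3)
     + r * (z 0 * al + z l * (l - al)).
Proof.
  intros Hl Hz Cdz.
  assert (Cz : forall x, continuous z x) by (intros x; eapply is_derive_continuous, Hz).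
  assert (Dq : forall x, is_derive (fun x => al - x) x (-1)) by (intros; auto_derive; auto; ring).
  assert (Cq : forall x, continuous (fun x => al - x) x)
    by (intros x; eapply is_derive_continuous, Dq).
  assert (C1 : forall x, continuous (fun x => dz x ^ 2) x) by (intros; apply continuous_sq; auto).
  assert (C2 : forall x, continuous (fun x => dz x * (al - x)) x)
    by (intros x; apply continuous_mult_R; auto).
  assert (C3 : forall x, continuous (fun x => (al - x) ^ 2) x)
    by (intros x; apply (continuous_sq (fun x => al - x)); auto).
  assert (H1 : RInt (fun x => dz x * (al - x) - z x) 0 l = z l * (al - l) - z 0 * (al - 0)).
  { apply (is_RInt_derive_cont (fun x => z x * (al - x))).
    - intros x. eapply is_derive_ext_l_eq; [apply is_derive_mult_R; auto|ring].
    - intros x; apply continuous_minus_R; auto. }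
  rewrite RInt_minus_R in H1 by auto.
  assert (H2 : r * RInt (fun x => dz x * (al - x)) 0 l <=
     / 2 * RInt (fun x => dz x ^ 2) 0 l + r ^ 2 / 2 * RInt (fun x => (al - x) ^ 2) 0 l).
  { rewrite <- !RInt_scal_R, <- RInt_plus_R by (auto; intros; apply continuous_scal_R; auto).
    apply RInt_le; auto.
    - apply ex_RInt_cont; intros; apply continuous_scal_R; auto.
    - apply ex_RInt_cont; intros x; apply continuous_plus_R; apply continuous_scal_R; auto.
    - intros x _. assert (0 <= (dz x - r * (al - x)) ^ 2) by apply pow2_ge_0. nra. }
  rewrite (is_RInt_unique _ _ _ _ (is_RInt_poly2 al l)) in H2.
  replace (RInt (fun x => dz x * (al - x)) 0 l) with
    (RInt z 0 l + (z l * (al - l) - z 0 * al)) in H2 by lra.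
  nra.
Qed.

Lemma gop_energy G gam g :
  wf_graph G -> is_green G gam -> (forall e t, continuous (g e) t) ->
  rsum (nE G) (fun e => RInt (fun x => dgop G gam g e x ^ 2) 0 (len G e)) =
  rsum (nE G) (fun e => RInt (fun x => g e x * gop G gam g e x) 0 (len G e)).
Proof.
  intros Hwf Hgr Hg.
  assert (H0 := lsum_split_end G (nod G gam g) (fun e => dgop G gam g e 0)
     (fun e => - dgop G gam g e (len G e)) Hwf (nod_root G gam g Hgr)
     (fun v => gop_kirchhoff G gam g v Hgr)).
  change (rsum (nE G)) with (lsum (seq 0 (nE G))).
  transitivity (lsum (seq 0 (nE G)) (fun e => RInt (fun x => g e x * gop G gam g e x) 0 (len G e) +
    (-1) * (nod G gam g (orig G e) * dgop G gam g e 0 + nod G gam g (term G e) * - dgop G gam g e (len G e)))).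
  - apply lsum_ext; intros e He; apply in_seq in He.
    rewrite (edge_by_parts (gop G gam g e) (dgop G gam g e) (g e)).
    + rewrite gop_orig, gop_term; [ring|]. apply Hwf; lia.
    + intros; apply is_derive_gop; auto.
    + intros; apply is_derive_dgop; auto.
    + auto.
  - rewrite lsum_plus, lsum_scal, H0; ring.
Qed.

(** Dual (Thomson) bound: the energy is the integral of g z; there [g] is replaced by the constant
    [r] at a cost eps Z per unit length, and the integral of r z is bounded through the flow
    [al]. *)
Lemma gop_energy_le G gam g al r eps Z :
  wf_graph G -> is_green G gam -> (forall e t, continuous (g e) t) ->
  (forall v, (v < nV G)%nat -> v <> hvert G 0 ->
       vdiv G (seq 0 (nE G)) al (fun e => len G e - al e) v = 0) ->
  0 <= eps -> 0 <= Z ->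
  (forall e x, (e < nE G)%nat -> 0 <= x <= len G e ->
     Rabs (g e x - r) <= eps /\ Rabs (gop G gam g e x) <= Z) ->
  3 * rsum (nE G) (fun e => RInt (fun x => dgop G gam g e x ^ 2) 0 (len G e)) <=
  r ^ 2 * rsum (nE G) (fun e => al e ^ 3 + (len G e - al e) ^ 3) + 6 * eps * Z * rsum (nE G) (len G).
Proof.
  intros Hwf Hgr Hg Hal Heps HZ Hb.
  assert (H0 := lsum_split_end G (nod G gam g) al (fun e => len G e - al e) Hwf (nod_root G gam g Hgr) Hal).
  assert (Cg : forall e x, continuous (gop G gam g e) x)
    by (intros; eapply is_derive_continuous, is_derive_gop; auto).
  assert (Cd : forall e x, continuous (dgop G gam g e) x)
    by (intros; eapply is_derive_continuous, is_derive_dgop; auto).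
  assert (HA := gop_energy G gam g Hwf Hgr Hg).
  set (A := rsum (nE G) (fun e => RInt (fun x => dgop G gam g e x ^ 2) 0 (len G e))) in *.
  (* Young's inequality leaves half of the energy on the right; absorbing it and multiplying by 3
     produces the factors 1 and 6 of the conclusion. *)
  assert (H : A <= / 2 * A + (r ^ 2 / 6 * rsum (nE G) (fun e => al e ^ 3 + (len G e - al e) ^ 3) +
     (r * 0 + eps * Z * rsum (nE G) (len G)))); [|lra].
  rewrite HA at 1. replace (r * 0) with (r * lsum (seq 0 (nE G)) (fun e =>
    nod G gam g (orig G e) * al e + nod G gam g (term G e) * (len G e - al e))) by (rewrite H0; ring).
  unfold A.
  change (rsum (nE G)) with (lsum (seq 0 (nE G))).
  rewrite <- !lsum_scal, <- !lsum_plus. apply lsum_le; intros e He; apply in_seq in He.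
  assert (He' : (e < nE G)%nat) by lia.
  destruct (proj1 Hwf e He') as [_ [_ Hl]].
  assert (Hf := edge_flow_le (gop G gam g e) (dgop G gam g e) (len G e) (al e) r ltac:(lra)
    (fun x => is_derive_gop G gam g e x (Hg e)) (Cd e)).
  rewrite gop_orig, gop_term in Hf by auto.
  assert (Cgz : forall x, continuous (fun x => g e x * gop G gam g e x) x)
    by (intros x; apply continuous_mult_R; auto).
  assert (Cgr : forall x, continuous (fun x => (g e x - r) * gop G gam g e x) x).
  { intros x; apply (continuous_mult_R (fun x => g e x - r)); auto.
    apply continuous_minus_R; auto. apply continuous_const. }
  assert (Hs : RInt (fun x => g e x * gop G gam g e x) 0 (len G e) =
     RInt (fun x => (g e x - r) * gop G gam g e x) 0 (len G e) + r * RInt (gop G gam g e) 0 (len G e)).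
  { rewrite <- RInt_scal_R, <- RInt_plus_R by (auto; intros; apply continuous_scal_R; auto).
    apply RInt_ext; intros x _; simpl; apply Rminus_diag_uniq; ring. }
  assert (Hd : Rabs (RInt (fun x => (g e x - r) * gop G gam g e x) 0 (len G e)) <= (len G e - 0) * (eps * Z)).
  { apply RInt_abs_le; auto; [lra|]. intros t Ht; rewrite Rabs_mult.
    destruct (Hb e t He' Ht). apply Rmult_le_compat; auto; apply Rabs_pos. }
  apply Rabs_le_between in Hd. rewrite Hs. lra.
Qed.

(** * The soliton tail on the half-line *)

Lemma is_RInt_gen_of_lim (f : R -> R) (I : R) :
  (forall x, continuous f x) -> is_lim (fun x => RInt f 0 x) p_infty I ->
  is_RInt_gen f (at_point 0) (Rbar_locally p_infty) I.
Proof.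
  intros Hf Hl P HP.
  apply (Filter_prod _ _ _ (fun a => a = 0) (fun b => P (RInt f 0 b))).
  - reflexivity.
  - apply (Hl P HP).
  - intros a b Ha Hb; simpl in *; subst a. exists (RInt f 0 b); split; auto.
    apply (RInt_correct f), ex_RInt_cont, Hf.
Qed.

(** The partial integrals increase and are bounded by C / c, so their supremum is the limit. The
    explicit bound later makes the half-line integral of v^p uniform in p. *)
Lemma is_lim_RInt_dominated (f : R -> R) C c :
  0 <= C -> 0 < c -> (forall x, continuous f x) ->
  (forall x, 0 <= x -> 0 <= f x <= C * exp (- (c * x))) ->
  exists I, is_lim (fun x => RInt f 0 x) p_infty (Finite I) /\ 0 <= I <= C / c.
Proof.
  intros HC Hc Hf Hb.
  assert (Hexp : forall x, is_RInt (fun x => C * exp (- (c * x))) 0 x (C / c * (1 - exp (- (c * x))))).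
  { intros x. replace (C / c * (1 - exp (- (c * x)))) with
      (minus (- (C / c) * exp (- (c * x))) (- (C / c) * exp (- (c * 0)))).
    - apply (is_RInt_derive (fun x => - (C / c) * exp (- (c * x)))).
      + intros t _; auto_derive; auto; field; lra.
      + intros t _; apply (is_derive_continuous _ t (- (c * C * exp (- (c * t))))); auto_derive; auto; ring.
    - unfold minus, plus, opp; simpl. rewrite Rmult_0_r, Ropp_0, exp_0; ring. }
  assert (Hmono : forall a b, 0 <= a <= b -> RInt f 0 a <= RInt f 0 b).
  { intros a b Hab.
    rewrite <- (RInt_Chasles f 0 a b) by (apply ex_RInt_cont; auto).
    assert (0 <= RInt f a b); [|unfold plus; simpl; lra].
    apply RInt_ge_0; [lra|apply ex_RInt_cont; auto|]. intros x Hx; apply Hb; lra. }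
  assert (H0 : RInt f 0 0 = 0) by apply (RInt_point 0 f).
  assert (Hup : forall x, 0 <= x -> RInt f 0 x <= C / c).
  { intros x Hx. apply Rle_trans with (C / c * (1 - exp (- (c * x)))).
    - rewrite <- (is_RInt_unique _ _ _ _ (Hexp x)).
      apply RInt_le; auto; [apply ex_RInt_cont; auto|eexists; apply Hexp|].
      intros t Ht; apply Hb; lra.
    - assert (He := exp_pos (- (c * x))).
      assert (0 <= C / c) by (apply Rmult_le_pos; [lra|left; apply Rinv_0_lt_compat; lra]). nra. }
  destruct (completeness (fun y => exists x, 0 <= x /\ y = RInt f 0 x)) as [I [HI1 HI2]].
  - exists (C / c); intros y [x [Hx ->]]; auto.
  - exists (RInt f 0 0), 0; split; [lra|reflexivity].
  - exists I; split.
    + apply is_lim_spec; intros eps.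
      destruct (classic (exists x, 0 <= x /\ I - eps < RInt f 0 x)) as [[x0 [Hx0 Hlt]]|Hno].
      * exists x0; intros x Hx. assert (RInt f 0 x0 <= RInt f 0 x) by (apply Hmono; lra).
        assert (RInt f 0 x <= I) by (apply HI1; exists x; split; [lra|reflexivity]).
        destruct eps as [eps He]; simpl in *. apply Rabs_def1; lra.
      * exfalso. destruct eps as [eps He]; simpl in *.
        assert (I <= I - eps); [|lra]. apply HI2; intros y [x [Hx ->]].
        apply Rnot_lt_le; intros H; apply Hno; exists x; auto.
    + split; [rewrite <- H0; apply HI1; exists 0; split; [lra|reflexivity]|].
      apply HI2; intros y [x [Hx ->]]; auto.
Qed.

Lemma is_lim_exp_decay C c : 0 < c -> is_lim (fun x => C * exp (- (c * x))) p_infty 0.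
Proof.
  intros Hc. replace (Finite 0) with (Rbar_mult C 0) by (simpl; f_equal; ring).
  apply is_lim_scal_l.
  apply is_lim_comp with m_infty; [apply is_lim_exp_m| |exists 0; intros; discriminate].
  apply is_lim_ext with (fun x => (- c) * x); [intros; ring|].
  assert (H := is_lim_scal_l (fun x => x) (- c) p_infty p_infty (is_lim_id p_infty)).
  replace m_infty with (Rbar_mult (- c) p_infty); [exact H|].
  rewrite Rbar_mult_comm. apply is_Rbar_mult_unique, is_Rbar_mult_p_infty_neg. simpl; lra.
Qed.

(* The tail [cosh(b (x + a))^(-2/(p-2))] of the soliton, normalised at [0];
   [q0 = exp(-2 b a)]. *)
Definition sol_log b q0 x := b * x + ln (1 + q0 * exp (- (2 * b * x))) - ln (1 + q0).
Definition sol p b q0 x := exp (- (2 / (p - 2)) * sol_log b q0 x).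
(** This is tanh (b (x + a)), with [q0] in place of the shift. *)
Definition sol_th b q0 x := (1 - q0 * exp (- (2 * b * x))) / (1 + q0 * exp (- (2 * b * x))).

Lemma sol_den b q0 x : 0 <= q0 -> 0 < 1 + q0 * exp (- (2 * b * x)).
Proof. intros H; assert (He := exp_pos (- (2 * b * x))); nra. Qed.

Lemma is_derive_sol p b q0 x :
  0 <= q0 -> 2 < p ->
  is_derive (sol p b q0) x (- (2 * b / (p - 2)) * sol_th b q0 x * sol p b q0 x).
Proof.
  intros Hq Hp. assert (Hd := sol_den b q0 x Hq).
  unfold sol, sol_log, sol_th. auto_derive; [auto|]. unfold Rminus; field; split; lra.
Qed.

Lemma is_derive_sol_th b q0 x :
  0 <= q0 -> is_derive (sol_th b q0) x (b * (1 - sol_th b q0 x ^ 2)).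
Proof.
  intros Hq. assert (Hd := sol_den b q0 x Hq).
  unfold sol_th. auto_derive; [lra|]. field; lra.
Qed.

Lemma sol_0 p b q0 : 0 <= q0 -> sol p b q0 0 = 1.
Proof.
  intros Hq; transitivity (exp 0); [|apply exp_0].
  unfold sol, sol_log; f_equal. rewrite (Rmult_0_r (2 * b)), Ropp_0, exp_0, Rmult_1_r; ring.
Qed.

Lemma sol_th_abs b q0 x : 0 <= q0 -> sol_th b q0 x ^ 2 <= 1.
Proof.
  intros Hq. assert (Hd := sol_den b q0 x Hq). assert (He := exp_pos (- (2 * b * x))).
  set (q := q0 * exp (- (2 * b * x))) in *.
  assert (0 <= q) by (apply Rmult_le_pos; lra).
  unfold sol_th; fold q.
  replace (((1 - q) / (1 + q)) ^ 2) with (1 - 4 * q / (1 + q) ^ 2) by (field; lra).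
  assert (0 <= 4 * q / (1 + q) ^ 2); [|lra].
  apply Rmult_le_pos; [lra|left; apply Rinv_0_lt_compat, pow_lt; lra].
Qed.

(** The relation between [q0] and [s] says s = cosh (b a)^2, and the claim is sech^2 = 1 - tanh^2.
    It makes the nonlinearity polynomial in [sol_th]. *)
Lemma sol_power p b q0 s x :
  2 < p -> 0 < q0 -> (1 + q0) ^ 2 = 4 * s * q0 ->
  Rpower (sol p b q0 x) (p - 2) = s * (1 - sol_th b q0 x ^ 2).
Proof.
  intros Hp Hq Hs. assert (Hd := sol_den b q0 x (Rlt_le _ _ Hq)).
  unfold Rpower, sol. rewrite ln_exp.
  replace ((p - 2) * (- (2 / (p - 2)) * sol_log b q0 x)) with (- 2 * sol_log b q0 x) by (field; lra).
  unfold sol_log, sol_th.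
  replace (-2 * (b * x + ln (1 + q0 * exp (- (2 * b * x))) - ln (1 + q0))) with
    (- (2 * b * x) + (- (ln (1 + q0 * exp (- (2 * b * x))) + ln (1 + q0 * exp (- (2 * b * x)))) +
      (ln (1 + q0) + ln (1 + q0)))) by ring.
  rewrite exp_plus. set (E := exp (- (2 * b * x))) in *.
  rewrite exp_plus, exp_Ropp, !exp_plus, !exp_ln by lra.
  transitivity (E * (1 + q0) ^ 2 / (1 + q0 * E) ^ 2); [field; lra|].
  rewrite Hs; field; lra.
Qed.

(** [sol_log] is at least b x - ln 2, and the exponent 4 / (p - 2) is at most 1 when p is at least
    6; hence the prefactor 2. *)
Lemma sol_sq_bound p b q0 x :
  6 <= p -> 0 < q0 <= 1 -> 0 < b -> 0 <= x ->
  0 <= sol p b q0 x ^ 2 <= 2 * exp (- (2 * (2 * b / (p - 2)) * x)).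
Proof.
  intros Hp Hq Hb Hx. split; [apply pow2_ge_0|].
  unfold sol. replace (exp (- (2 / (p - 2)) * sol_log b q0 x) ^ 2) with
    (exp (- (2 / (p - 2)) * sol_log b q0 x + - (2 / (p - 2)) * sol_log b q0 x))
    by (rewrite exp_plus; ring).
  replace (2 * exp (- (2 * (2 * b / (p - 2)) * x))) with (exp (ln 2 + - (2 * (2 * b / (p - 2)) * x)))
    by (rewrite exp_plus, exp_ln; lra).
  assert (Hl2 : ln (1 + q0) <= ln 2) by (apply ln_le; lra).
  assert (Hl1 : 0 <= ln (1 + q0 * exp (- (2 * b * x)))).
  { rewrite <- ln_1. apply ln_le; [lra|].
    assert (He := exp_pos (- (2 * b * x))). nra. }
  assert (Hm : 0 < / (p - 2) <= / 4).
  { split; [apply Rinv_0_lt_compat; lra|apply Rinv_le_contravar; lra]. }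
  assert (Hln : 0 < ln 2) by (rewrite <- ln_1; apply ln_increasing; lra).
  assert (Hle : - (2 / (p - 2)) * sol_log b q0 x + - (2 / (p - 2)) * sol_log b q0 x <=
      ln 2 + - (2 * (2 * b / (p - 2)) * x)).
  { unfold sol_log, Rdiv. set (m := / (p - 2)) in *.
    set (L1 := ln (1 + q0 * exp (- (2 * b * x)))) in *. set (L2 := ln (1 + q0)) in *.
    assert (0 <= m * L1) by (apply Rmult_le_pos; lra).
    assert (m * L2 <= / 4 * ln 2).
    { apply Rle_trans with (m * ln 2); [apply Rmult_le_compat_l; lra|apply Rmult_le_compat_r; lra]. }
    nra. }
  destruct Hle as [Hlt|Heq]; [left; apply exp_increasing; exact Hlt|rewrite Heq; right; reflexivity].
Qed.

(** The condition on [D] is the first integral v'^2 = kap (sig v^2 - (2/p) v^p) read at v = 1.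
    Combined with the equation it gives (v v')' = 2 v'^2 - kap (1 - 2/p) v^p, whose integral is the
    identity between [A], [B] and [D]. *)
Lemma half_line_solution p kap sig D :
  6 <= p <= 7 -> 0 < kap -> 1 / 4 <= sig <= 1 / 2 -> 0 <= D -> D ^ 2 = kap * (sig - 2 / p) ->
  exists (v dv : R -> R) (M A B : R),
    v 0 = 1 /\ dv 0 = - D /\
    (forall x, 0 < v x /\ is_derive v x (dv x) /\
       is_derive dv x (kap * (sig * v x - Rpower (v x) (p - 1)))) /\
    is_RInt_gen (fun x => v x ^ 2) (at_point 0) (Rbar_locally p_infty) M /\
    is_RInt_gen (fun x => dv x ^ 2) (at_point 0) (Rbar_locally p_infty) A /\
    is_RInt_gen (fun x => Rpower (v x) p) (at_point 0) (Rbar_locally p_infty) B /\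
    0 <= M /\ 2 * A - kap * (1 - 2 / p) * B = D /\ 0 <= B <= 4 / sqrt kap.
Proof.
  intros Hp Hk Hs HD HD2.
  set (c := sqrt (kap * sig)).
  assert (Hks : 0 < kap * sig) by (apply Rmult_lt_0_compat; lra).
  assert (Hc : 0 < c) by (apply sqrt_lt_R0; auto).
  assert (Hc2 : c * c = kap * sig) by (apply sqrt_sqrt; lra).
  (* [c] is the decay rate of the tail and [th] the value of tanh at 0, because the logarithmic
     slope of the profile is - c tanh. As [D] is nonnegative, the tail starts at or beyond the
     peak. *)
  set (th := D / c).
  assert (HDth : D = th * c) by (unfold th; field; lra).
  assert (Hth0 : 0 <= th) by (apply Rmult_le_pos; [lra|left; apply Rinv_0_lt_compat; auto]).
  assert (Hth2 : p * sig * (1 - th ^ 2) = 2).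
  { assert (E : kap * sig * th ^ 2 = kap * sig - kap * (2 / p)).
    { rewrite <- Hc2 at 1. replace (c * c * th ^ 2) with ((th * c) ^ 2) by ring.
      rewrite <- HDth, HD2; ring. }
    apply Rmult_eq_reg_l with kap; [|lra].
    replace (kap * (p * sig * (1 - th ^ 2))) with (p * (kap * sig - kap * sig * th ^ 2)) by ring.
    rewrite E; field; lra. }
  assert (Hth1 : th < 1).
  { apply Rnot_le_lt; intros H.
    assert (p * sig * (th ^ 2 - 1) >= 0); [|lra].
    apply Rle_ge, Rmult_le_pos; [apply Rmult_le_pos; lra|nra]. }
  set (q0 := (1 - th) / (1 + th)).
  assert (Hq : 0 < q0 <= 1).
  { unfold q0; split; [apply Rmult_lt_0_compat; [lra|apply Rinv_0_lt_compat; lra]|].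
    apply Rmult_le_reg_r with (1 + th); [lra|]. unfold Rdiv; rewrite Rmult_assoc, Rinv_l; lra. }
  set (b := (p - 2) / 2 * c).
  assert (Hb : 0 < b) by (apply Rmult_lt_0_compat; lra).
  assert (Hbc : 2 * b / (p - 2) = c) by (unfold b; field; lra).
  (* The peak of the soliton raised to the power p - 2. *)
  set (s := p * sig / 2).
  assert (Hs' : (1 + q0) ^ 2 = 4 * s * q0).
  { unfold s, q0. replace (4 * (p * sig / 2) * ((1 - th) / (1 + th))) with
      (2 * (p * sig * (1 - th ^ 2)) / (1 + th) ^ 2) by (field; lra).
    rewrite Hth2; field; lra. }
  assert (Hs2 : 0 <= s <= 2) by (unfold s; split; nra).
  set (v := sol p b q0). set (t := sol_th b q0). set (dv := fun x => - c * t x * v x).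
  assert (Hv : forall x, 0 < v x) by (intros; apply exp_pos).
  assert (Dv : forall x, is_derive v x (dv x)).
  { intros x; unfold dv; rewrite <- Hbc. apply is_derive_sol; lra. }
  assert (Dt : forall x, is_derive t x (b * (1 - t x ^ 2))) by (intros; apply is_derive_sol_th; lra).
  assert (Hpow : forall x, Rpower (v x) (p - 2) = s * (1 - t x ^ 2)) by (intros; apply sol_power; lra).
  assert (Hpow1 : forall x, Rpower (v x) (p - 1) = s * (1 - t x ^ 2) * v x).
  { intros x; replace (p - 1) with ((p - 2) + 1) by ring. rewrite Rpower_plus, Hpow, Rpower_1; auto. }
  assert (Hpow2 : forall x, Rpower (v x) p = s * (1 - t x ^ 2) * v x ^ 2).
  { intros x; replace p with ((p - 1) + 1) at 1 by ring.
    rewrite Rpower_plus, Hpow1, Rpower_1; auto; ring. }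
  assert (Ddv : forall x, is_derive dv x (kap * (sig * v x - Rpower (v x) (p - 1)))).
  { intros x. eapply is_derive_ext_l_eq.
    - apply (is_derive_mult_R (fun x => - c * t x) v); [|apply Dv].
      apply (is_derive_scal t); apply Dt.
    - rewrite Hpow1; unfold dv, b, s.
      replace (- c * ((p - 2) / 2 * c * (1 - t x ^ 2)) * v x + - c * t x * (- c * t x * v x)) with
        (c * c * (t x ^ 2 - (p - 2) / 2 * (1 - t x ^ 2)) * v x) by field.
      rewrite Hc2; field. }
  assert (Cv : forall x, continuous v x) by (intros; eapply is_derive_continuous, Dv).
  assert (Ct : forall x, continuous t x) by (intros; eapply is_derive_continuous, Dt).
  assert (Cdv : forall x, continuous dv x) by (intros; eapply is_derive_continuous, Ddv).
  assert (Ht : forall x, t x ^ 2 <= 1) by (intros; apply sol_th_abs; lra).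
  assert (Hv2 : forall x, 0 <= x -> 0 <= v x ^ 2 <= 2 * exp (- (2 * c * x))).
  { intros x Hx. rewrite <- Hbc. apply sol_sq_bound; lra. }
  assert (Cpow : forall x, continuous (fun x => Rpower (v x) p) x).
  { intros x; apply (continuous_ext (fun x => s * (1 - t x ^ 2) * v x ^ 2)); [intros y; symmetry; apply Hpow2|].
    apply continuous_mult_R; [|apply continuous_sq; auto].
    apply continuous_scal_R, continuous_minus_R; [apply continuous_const|apply continuous_sq; auto]. }
  destruct (is_lim_RInt_dominated (fun x => v x ^ 2) 2 (2 * c)) as [M [HM [HM0 _]]];
    [lra|lra|intros; apply continuous_sq; auto|auto|].
  destruct (is_lim_RInt_dominated (fun x => dv x ^ 2) (2 * c ^ 2) (2 * c)) as [A [HA _]];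
    [assert (0 <= c ^ 2) by apply pow2_ge_0; lra|lra|intros; apply continuous_sq; auto| |].
  { intros x Hx. split; [apply pow2_ge_0|]. unfold dv.
    replace ((- c * t x * v x) ^ 2) with (c ^ 2 * (t x ^ 2 * v x ^ 2)) by ring.
    rewrite (Rmult_comm 2), Rmult_assoc. apply Rmult_le_compat_l; [apply pow2_ge_0|].
    specialize (Hv2 x Hx). specialize (Ht x). assert (0 <= t x ^ 2) by apply pow2_ge_0. nra. }
  destruct (is_lim_RInt_dominated (fun x => Rpower (v x) p) 4 (2 * c)) as [B [HB HB0]];
    [lra|lra|auto| |].
  { intros x Hx. split; [left; apply exp_pos|]. rewrite Hpow2.
    specialize (Hv2 x Hx). specialize (Ht x). assert (0 <= t x ^ 2) by apply pow2_ge_0.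
    assert (s * (1 - t x ^ 2) <= 2 * 1) by (apply Rmult_le_compat; lra).
    assert (0 <= s * (1 - t x ^ 2)) by (apply Rmult_le_pos; lra). nra. }
  exists v, dv, M, A, B.
  assert (Hv0 : v 0 = 1) by (apply sol_0; lra).
  assert (Hdv0 : dv 0 = - D).
  { unfold dv; rewrite Hv0, HDth. unfold t, sol_th.
    rewrite Rmult_0_r, Ropp_0, exp_0. unfold q0; field; lra. }
  repeat (match goal with |- _ /\ _ => split end); auto;
    try (apply is_RInt_gen_of_lim; auto; intros; apply continuous_sq; auto); try lra.
  (* The limit of v v' + D is computed twice: as an integral here, and as [D] by exponential decay
     afterwards. *)
  - assert (HF : is_lim (fun x => v x * dv x + D) p_infty (2 * A - kap * (1 - 2 / p) * B)).
    { apply is_lim_ext with (fun x => 2 * RInt (fun x => dv x ^ 2) 0 x -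
        kap * (1 - 2 / p) * RInt (fun x => Rpower (v x) p) 0 x).
      - intros x. replace (v x * dv x + D) with (v x * dv x - v 0 * dv 0) by (rewrite Hv0, Hdv0; ring).
        rewrite <- !RInt_scal_R, <- RInt_minus_R
          by (auto; intros; try apply continuous_scal_R; auto; apply continuous_sq; auto).
        apply (is_RInt_derive_cont (fun x => v x * dv x)).
        + intros y. eapply is_derive_ext_l_eq; [apply is_derive_mult_R; auto|].
          rewrite Hpow1, Hpow2. unfold dv, s.
          transitivity (c * c * t y ^ 2 * v y ^ 2 + kap * sig * (1 - p / 2 * (1 - t y ^ 2)) * v y ^ 2); [field|].
          transitivity (2 * (c * c) * t y ^ 2 * v y ^ 2 -
             kap * sig * (1 - t y ^ 2) * (p - 2) / 2 * v y ^ 2); [rewrite Hc2; field|field; lra].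
        + intros y; apply continuous_minus_R; apply continuous_scal_R; auto; apply continuous_sq; auto.
      - apply (is_lim_minus' (fun x => 2 * RInt (fun x => dv x ^ 2) 0 x)).
        + apply (is_lim_scal_l _ 2 p_infty A HA).
        + apply (is_lim_scal_l _ (kap * (1 - 2 / p)) p_infty B HB). }
    assert (HF' : is_lim (fun x => v x * dv x + D) p_infty D).
    { replace (Finite D) with (Finite (0 + D)) by (f_equal; ring).
      apply is_lim_plus'; [|apply is_lim_const].
      apply is_lim_le_le_loc with (f := fun x => (- 2 * c) * exp (- (2 * c * x)))
        (g := fun x => (2 * c) * exp (- (2 * c * x))); try (apply is_lim_exp_decay; lra).
      exists 0; intros x Hx. specialize (Hv2 x ltac:(lra)).
      assert (Ht1 : Rabs (t x) <= 1).
      { apply Rabs_le. specialize (Ht x). split; nra. }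
      apply Rabs_le_between in Ht1. unfold dv.
      replace (v x * (- c * t x * v x)) with (- (c * (t x * v x ^ 2))) by ring.
      assert (- (2 * exp (- (2 * c * x))) <= t x * v x ^ 2 <= 2 * exp (- (2 * c * x))) by (split; nra).
      split; nra. }
    apply is_lim_unique in HF. apply is_lim_unique in HF'.
    rewrite HF in HF'. injection HF'; auto.
  (* The bound sig >= 1/4 enters here: it gives 2 c >= sqrt kap. *)
  - apply Rle_trans with (4 / (2 * c)); [lra|].
    unfold Rdiv; apply Rmult_le_compat_l; [lra|].
    apply Rinv_le_contravar; [apply sqrt_lt_R0; auto|].
    apply Rsqr_incr_0_var; [|lra]. unfold Rsqr. rewrite sqrt_sqrt by lra. nra.
Qed.

(** * The solution on the core *)

(** The sign is that of - v'' = kap [nl], so that [nl] is the datum of the Green operator; it is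
    positive near v = 1 and s = 2/p. *)
Definition nl (p s v : R) : R := Rpower v (p - 1) - s * v.

Lemma is_derive_Rpower a x : 0 < x -> is_derive (fun v => Rpower v a) x (a * Rpower x (a - 1)).
Proof. intros Hx; apply is_derive_Reals, derivable_pt_lim_power; auto. Qed.

Lemma is_derive_nl p s v :
  0 < v -> is_derive (nl p s) v ((p - 1) * Rpower v (p - 2) - s).
Proof.
  intros Hv; unfold nl.
  replace (p - 2) with (p - 1 - 1) by ring.
  apply (is_derive_minus (fun v => Rpower v (p - 1)) (fun v => s * v)).
  - apply is_derive_Rpower; auto.
  - auto_derive; auto; ring.
Qed.

Lemma continuous_Rpower a x : 0 < x -> continuous (fun v => Rpower v a) x.
Proof. intros Hx; eapply is_derive_continuous, is_derive_Rpower; auto. Qed.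

Lemma Rpower_le_pow v a n : 0 < v <= 11 / 10 -> 0 <= a <= INR n -> Rpower v a <= (11 / 10) ^ n.
Proof.
  intros Hv Ha. rewrite <- Rpower_pow by lra.
  apply Rle_trans with (Rpower (11 / 10) a); [apply Rle_Rpower_l; lra|apply Rle_Rpower; lra].
Qed.

Lemma Rpower_ge_pow v a n : 9 / 10 <= v -> 0 <= a <= INR n -> (9 / 10) ^ n <= Rpower v a.
Proof.
  intros Hv Ha. rewrite <- Rpower_pow by lra.
  apply Rle_trans with (Rpower (9 / 10) a); [|apply Rle_Rpower_l; lra].
  unfold Rpower. assert (Hl : ln (9 / 10) < 0) by (rewrite <- ln_1; apply ln_increasing; lra).
  assert (Hle : INR n * ln (9 / 10) <= a * ln (9 / 10)) by nra.
  destruct Hle as [H| ->]; [left; apply exp_increasing; auto|right; reflexivity].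
Qed.

(** Since p - 2 is at most 5, fifth powers of 9/10 and 11/10 suffice. The lower bound gives
    convexity of the potential, the upper bound the Lipschitz constant. *)
Lemma nl_derive_bounds p s v :
  6 <= p <= 7 -> 1 / 4 <= s <= 1 / 2 -> 9 / 10 <= v <= 11 / 10 ->
  0 <= (p - 1) * Rpower v (p - 2) - s <= 10.
Proof.
  intros Hp Hs Hv.
  assert (H1 : Rpower v (p - 2) <= (11 / 10) ^ 5) by (apply Rpower_le_pow; simpl; lra).
  assert (H2 : (9 / 10) ^ 5 <= Rpower v (p - 2)) by (apply Rpower_ge_pow; simpl; lra).
  simpl in H1, H2. split; nra.
Qed.

Lemma between_core a b c : 9 / 10 <= a <= 11 / 10 -> 9 / 10 <= b <= 11 / 10 ->
  Rmin a b <= c <= Rmax a b -> 9 / 10 <= c <= 11 / 10.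
Proof.
  intros Ha Hb Hc. unfold Rmin, Rmax in Hc; destruct (Rle_dec a b); lra.
Qed.

Lemma nl_MVT p s a b : 9 / 10 <= a <= 11 / 10 -> 9 / 10 <= b <= 11 / 10 ->
  exists c, Rmin a b <= c <= Rmax a b /\
    nl p s b - nl p s a = ((p - 1) * Rpower c (p - 2) - s) * (b - a).
Proof.
  intros Ha Hb. apply (MVT_gen (nl p s) a b).
  - intros x Hx; apply is_derive_nl.
    assert (9 / 10 <= x <= 11 / 10) by (apply (between_core a b); auto; lra). lra.
  - intros x Hx; apply continuity_pt_filterlim.
    eapply is_derive_continuous, is_derive_nl.
    assert (9 / 10 <= x <= 11 / 10) by (apply (between_core a b); auto; lra). lra.
Qed.

Lemma nl_lipschitz p s s' v v' c :
  6 <= p <= 7 -> 1 / 4 <= s <= 1 / 2 -> 1 / 4 <= s' <= 1 / 2 ->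
  9 / 10 <= v <= 11 / 10 -> 9 / 10 <= v' <= 11 / 10 ->
  Rabs (v - v') <= c -> Rabs (s - s') <= c -> Rabs (nl p s v - nl p s' v') <= 12 * c.
Proof.
  intros Hp Hs Hs' Hv Hv' Hvc Hsc.
  destruct (nl_MVT p s v' v Hv' Hv) as [x [Hx E]].
  assert (Hx' : 9 / 10 <= x <= 11 / 10) by (apply (between_core v' v); auto).
  assert (Hd := nl_derive_bounds p s x Hp Hs Hx').
  replace (nl p s v - nl p s' v') with
    ((nl p s v - nl p s v') + (s' - s) * v') by (unfold nl; ring).
  rewrite E. eapply Rle_trans; [apply Rabs_triang|].
  rewrite !Rabs_mult, (Rabs_pos_eq _ (proj1 Hd)), (Rabs_pos_eq v'), (Rabs_minus_sym s') by lra.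
  assert (0 <= Rabs (v - v')) by apply Rabs_pos. assert (0 <= Rabs (s - s')) by apply Rabs_pos.
  nra.
Qed.

Lemma nl_bound p s v :
  6 <= p <= 7 -> 1 / 4 <= s <= 1 / 2 -> 9 / 10 <= v <= 11 / 10 -> Rabs (nl p s v) <= 2.
Proof.
  intros Hp Hs Hv. unfold nl.
  assert (H1 : Rpower v (p - 1) <= (11 / 10) ^ 6) by (apply Rpower_le_pow; simpl; lra).
  assert (H2 : 0 < Rpower v (p - 1)) by apply exp_pos. simpl in H1.
  apply Rabs_le; split; nra.
Qed.

(* Convexity of [F v = v^p / p - s v^2 / 2], whose derivative is [nl p s]. *)
Lemma potential_convex p s v :
  6 <= p <= 7 -> 1 / 4 <= s <= 1 / 2 -> 9 / 10 <= v <= 11 / 10 ->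
  Rpower v p / p - s / 2 * v ^ 2 <= (/ p - s / 2) + nl p s v * (v - 1).
Proof.
  intros Hp Hs Hv.
  set (F := fun v => Rpower v p / p - s / 2 * v ^ 2).
  assert (HF : forall x, 0 < x -> is_derive F x (nl p s x)).
  { intros x Hx. eapply is_derive_ext_l_eq.
    - apply (is_derive_minus (fun v => Rpower v p / p) (fun v => s / 2 * v ^ 2)).
      + apply (is_derive_ext (fun v => / p * Rpower v p)); [intros t; apply Rmult_comm|].
        apply is_derive_scal, is_derive_Rpower; auto.
      + apply (is_derive_ext_l_eq _ _ (s * x)); [auto_derive; auto; field|reflexivity].
    - unfold nl, minus, plus, opp; simpl. field; lra. }
  assert (H1 : 9 / 10 <= 1 <= 11 / 10) by lra.
  destruct (MVT_gen F 1 v (nl p s)) as [x [Hx E]].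
  - intros x Hx; apply HF.
    assert (9 / 10 <= x <= 11 / 10) by (apply (between_core 1 v); auto; lra). lra.
  - intros x Hx; apply continuity_pt_filterlim. eapply is_derive_continuous, HF.
    assert (9 / 10 <= x <= 11 / 10) by (apply (between_core 1 v); auto; lra). lra.
  - assert (Hx' : 9 / 10 <= x <= 11 / 10) by (apply (between_core 1 v); auto).
    destruct (nl_MVT p s x v Hx' Hv) as [z [Hz Ez]].
    assert (Hd := nl_derive_bounds p s z Hp Hs (between_core x v z Hx' Hv Hz)).
    assert (HF1 : F 1 = / p - s / 2).
    { unfold F, Rpower. rewrite ln_1, Rmult_0_r, exp_0; field; lra. }
    change (F v <= (/ p - s / 2) + nl p s v * (v - 1)). rewrite <- HF1.
    replace (F v) with (F 1 + nl p s x * (v - 1)) by lra.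
    assert (0 <= (nl p s v - nl p s x) * (v - 1)); [|nra].
    rewrite Ez, Rmult_assoc. apply Rmult_le_pos; [lra|].
    unfold Rmin, Rmax in Hx; destruct (Rle_dec 1 v); nra.
Qed.

(* A state [y] packs the profile on the core, [y e] for [e < nE G], together with
   the frequency parameter, stored as the constant [y (nE G) 0]. *)
Definition rho (G : MGraph) (p : R) (y : nat -> R -> R) (e : nat) (t : R) : R :=
  nl p (y (nE G) 0) (y e t).

Definition flux (G : MGraph) (p : R) (y : nat -> R -> R) : R :=
  rsum (nE G) (fun e => RInt (rho G p y e) 0 (len G e)).

(** Projection onto the edge. The uniform distance ranges over all real t, while [gop] is controlled
    on the edge only. *)
Definition clamp (l t : R) : R := Rmax 0 (Rmin l t).

(** The second branch is the matching condition with the half-line; every index from [nE G] on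
    stores the frequency. *)
Definition core_map G gam p kap (y : nat -> R -> R) (e : nat) (t : R) : R :=
  if Nat.ltb e (nE G) then 1 + kap * gop G gam (rho G p y) e (clamp (len G e) t)
  else 2 / p + kap * flux G p y ^ 2.

Definition core_box (G : MGraph) (y : nat -> R -> R) : Prop :=
  (forall e t, continuous (y e) t) /\
  (forall e t, (e < nE G)%nat -> 9 / 10 <= y e t <= 11 / 10) /\
  (forall e t, (nE G <= e)%nat -> 1 / 4 <= y e t <= 1 / 2).

Lemma clamp_in l t : 0 <= l -> 0 <= clamp l t <= l.
Proof. intros; unfold clamp, Rmax, Rmin; repeat destruct (Rle_dec _ _); lra. Qed.

Lemma clamp_id l t : 0 <= t <= l -> clamp l t = t.
Proof. intros; unfold clamp, Rmax, Rmin; repeat destruct (Rle_dec _ _); lra. Qed.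

Lemma continuous_clamp l x : continuous (clamp l) x.
Proof.
  apply continuity_pt_filterlim. intros eps He; exists eps; split; auto.
  intros t [_ Ht]. change (Rabs (t - x) < eps) in Ht. change (Rabs (clamp l t - clamp l x) < eps).
  eapply Rle_lt_trans; [|exact Ht].
  unfold clamp, Rmax, Rmin, Rabs; repeat destruct (Rle_dec _ _); repeat destruct (Rcase_abs _); lra.
Qed.

Lemma core_box_pos G y e t : core_box G y -> 0 < y e t.
Proof.
  intros [_ [H1 H2]]. destruct (Nat.lt_ge_cases e (nE G)) as [H|H].
  - specialize (H1 e t H); lra.
  - specialize (H2 e t H); lra.
Qed.

Lemma rho_continuous G p y e t : core_box G y -> continuous (rho G p y e) t.
Proof.
  intros Hy. unfold rho. apply (continuous_comp (y e) (nl p (y (nE G) 0))); [apply Hy|].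
  eapply is_derive_continuous, is_derive_nl, core_box_pos, Hy.
Qed.

Lemma core_box_sig G y : core_box G y -> 1 / 4 <= y (nE G) 0 <= 1 / 2.
Proof. intros [_ [_ H]]; apply H; auto. Qed.

Lemma rho_bound G p y e t :
  6 <= p <= 7 -> core_box G y -> (e < nE G)%nat -> Rabs (rho G p y e t) <= 2.
Proof.
  intros Hp Hy He; apply nl_bound; auto; [apply core_box_sig, Hy|apply Hy; auto].
Qed.

Lemma rho_lipschitz G p y y' c e t :
  6 <= p <= 7 -> core_box G y -> core_box G y' -> (e < nE G)%nat -> unif_dist_le y y' c ->
  Rabs (rho G p y e t - rho G p y' e t) <= 12 * c.
Proof.
  intros Hp Hy Hy' He Hc.
  apply nl_lipschitz; auto; try (apply core_box_sig; auto); [apply Hy|apply Hy']; auto.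
Qed.

Lemma lsum_RInt_abs_le G (h : nat -> R -> R) c :
  wf_graph G -> (forall e t, continuous (h e) t) ->
  (forall e t, (e < nE G)%nat -> 0 <= t <= len G e -> Rabs (h e t) <= c) ->
  Rabs (rsum (nE G) (fun e => RInt (h e) 0 (len G e))) <= c * rsum (nE G) (len G).
Proof.
  intros [Hw _] Ch Hb. change (rsum (nE G)) with (lsum (seq 0 (nE G))).
  rewrite <- lsum_scal. eapply Rle_trans; [apply lsum_abs|].
  apply lsum_le; intros e He; apply in_seq in He.
  destruct (Hw e) as [_ [_ Hl]]; [lia|].
  eapply Rle_trans; [apply RInt_abs_le with (c := c); [lra|apply Ch|]|].
  - intros t Ht; apply Hb; [lia|auto].
  - lra.
Qed.

(** The data have size 2 and Lipschitz constant 12. So 24 C kap <= 1 gives ratio 12 C kap <= 1/2 and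
    keeps the profile within 1/12 of 1. The flux is at most 2 K, so 96 K^2 kap <= 1 gives ratio 48
    K^2 kap <= 1/2 for the frequency and keeps it below 1/3 + 1/24. *)
Lemma core_fixed_point G gam C p kap :
  wf_graph G -> 6 <= p <= 7 -> 0 < kap -> 0 < C ->
  (forall g c, 0 <= c -> (forall e t, continuous (g e) t) ->
    (forall e x, (e < nE G)%nat -> 0 <= x <= len G e -> Rabs (g e x) <= c) ->
    forall e x, (e < nE G)%nat -> 0 <= x <= len G e -> Rabs (gop G gam g e x) <= C * c) ->
  24 * C * kap <= 1 -> 96 * rsum (nE G) (len G) ^ 2 * kap <= 1 ->
  exists y, core_box G y /\
    (forall e t, (e < nE G)%nat -> 0 <= t <= len G e -> y e t = 1 + kap * gop G gam (rho G p y) e t) /\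
    y (nE G) 0 = 2 / p + kap * flux G p y ^ 2 /\
    Rabs (flux G p y) <= 2 * rsum (nE G) (len G).
Proof.
  intros Hwf Hp Hk HC Hgop HkC HkK. set (K := rsum (nE G) (len G)) in *.
  assert (Hlen : forall e, (e < nE G)%nat -> 0 < len G e) by (intros; apply Hwf; auto).
  assert (HK0 : 0 <= K) by (apply lsum_nonneg; intros e He; apply in_seq in He; left; apply Hlen; lia).
  assert (Hp2 : 2 / 7 <= 2 / p <= 1 / 3).
  { unfold Rdiv. assert (/ 7 <= / p) by (apply Rinv_le_contravar; lra).
    assert (/ p <= / 6) by (apply Rinv_le_contravar; lra). lra. }
  assert (Hflux : forall y, core_box G y -> Rabs (flux G p y) <= 2 * K).
  { intros y Hy; apply lsum_RInt_abs_le; auto; intros; [apply rho_continuous; auto|apply rho_bound; auto]. }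
  assert (Hg2 : forall y e x, core_box G y -> (e < nE G)%nat -> 0 <= x <= len G e ->
     Rabs (gop G gam (rho G p y) e x) <= C * 2).
  { intros y e x Hy He Hx; apply Hgop; auto; [lra|intros; apply rho_continuous; auto|].
    intros; apply rho_bound; auto. }
  assert (Hf2 : forall y, core_box G y -> 0 <= kap * flux G p y ^ 2 <= 1 / 24).
  { intros y Hy. assert (H := Hflux y Hy). split; [apply Rmult_le_pos; [lra|apply pow2_ge_0]|].
    rewrite <- pow2_abs. assert (Rabs (flux G p y) ^ 2 <= (2 * K) ^ 2) by (apply pow_incr; split; [apply Rabs_pos|auto]).
    nra. }
  assert (Hbox : forall y, core_box G y -> core_box G (core_map G gam p kap y)).
  { intros y Hy; split; [|split].
    - intros e t. unfold core_map. destruct (Nat.ltb e (nE G)); [|apply continuous_const].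
      apply continuous_plus_R; [apply continuous_const|apply continuous_scal_R].
      apply (continuous_comp (clamp (len G e)) (gop G gam (rho G p y) e)); [apply continuous_clamp|].
      eapply is_derive_continuous, is_derive_gop. intros; apply rho_continuous; auto.
    - intros e t He. unfold core_map. rewrite (proj2 (Nat.ltb_lt _ _) He).
      assert (H := Hg2 y e (clamp (len G e) t) Hy He (clamp_in _ _ (Rlt_le _ _ (Hlen e He)))).
      apply Rabs_le_between in H. nra.
    - intros e t He. unfold core_map. rewrite (proj2 (Nat.ltb_ge _ _) He).
      assert (H := Hf2 y Hy). lra. }
  destruct (contraction_fixed_point (core_box G) (core_map G gam p kap)
    (* The starting state is the limit kap = 0 at p = 6; the first step is at most 1 because both
       states lie in the box. *)
    (fun e _ => if Nat.ltb e (nE G) then 1 else 1 / 3) 1) as [y [Hy Hfix]].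
  - split; [intros; apply continuous_const|split; intros e t He].
    + rewrite (proj2 (Nat.ltb_lt _ _) He); lra.
    + rewrite (proj2 (Nat.ltb_ge _ _) He); lra.
  - exact Hbox.
  - intros u l Hu Hl.
    assert (Hcl : forall e t a b, (forall n, a <= u n e t <= b) -> a <= l e t <= b).
    { intros e t a b Hab. split; apply Rnot_lt_le; intros Hlt.
      - destruct (Hl ((a - l e t) / 2)) as [n Hn]; [lra|].
        specialize (Hn e t). specialize (Hab n). apply Rabs_le_between in Hn. lra.
      - destruct (Hl ((l e t - b) / 2)) as [n Hn]; [lra|].
        specialize (Hn e t). specialize (Hab n). apply Rabs_le_between in Hn. lra. }
    split; [|split].
    + intros e t. apply (unif_limit_continuous u); [intros n s; apply Hu|exact Hl].
    + intros e t He; apply Hcl; intros n; apply Hu; auto.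
    + intros e t He; apply Hcl; intros n; apply Hu; auto.
  - intros y y' c Hc Hy Hy' Hyy e t. unfold core_map.
    destruct (Nat.ltb_spec e (nE G)) as [He|He].
    + set (s := clamp (len G e) t).
      assert (Hs : 0 <= s <= len G e) by (apply clamp_in; left; auto).
      replace (1 + kap * gop G gam (rho G p y) e s - (1 + kap * gop G gam (rho G p y') e s))
        with (kap * (gop G gam (rho G p y) e s - gop G gam (rho G p y') e s)) by ring.
      rewrite <- gop_minus by (intros; apply rho_continuous; auto).
      rewrite Rabs_mult, Rabs_pos_eq by lra.
      assert (H : Rabs (gop G gam (fun e t => rho G p y e t - rho G p y' e t) e s) <= C * (12 * c)).
      { apply Hgop; auto; [lra| |].
        - intros; apply continuous_minus_R; apply rho_continuous; auto.
        - intros; apply rho_lipschitz; auto. }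
      nra.
    + replace (2 / p + kap * flux G p y ^ 2 - (2 / p + kap * flux G p y' ^ 2)) with
        (kap * ((flux G p y - flux G p y') * (flux G p y + flux G p y'))) by ring.
      rewrite !Rabs_mult, (Rabs_pos_eq kap) by lra.
      assert (H1 : Rabs (flux G p y - flux G p y') <= 12 * c * K).
      { replace (flux G p y - flux G p y') with
          (rsum (nE G) (fun e => RInt (fun t => rho G p y e t - rho G p y' e t) 0 (len G e))).
        - apply (lsum_RInt_abs_le G (fun e t => rho G p y e t - rho G p y' e t)); auto.
          + intros; apply continuous_minus_R; apply rho_continuous; auto.
          + intros; apply rho_lipschitz; auto.
        - replace (flux G p y - flux G p y') with (flux G p y + (-1) * flux G p y') by ring.
          unfold flux; change (rsum (nE G)) with (lsum (seq 0 (nE G))).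
          rewrite <- lsum_scal, <- lsum_plus; apply lsum_ext; intros e' _.
          rewrite RInt_minus_R by (intros; apply rho_continuous; auto). ring. }
      assert (H2 : Rabs (flux G p y + flux G p y') <= 4 * K).
      { eapply Rle_trans; [apply Rabs_triang|].
        generalize (Hflux y Hy) (Hflux y' Hy'); lra. }
      assert (H3 : Rabs (flux G p y - flux G p y') * Rabs (flux G p y + flux G p y') <= 12 * c * K * (4 * K))
        by (apply Rmult_le_compat; auto; apply Rabs_pos).
      nra.
  - set (x0 := fun (e : nat) (_ : R) => if Nat.ltb e (nE G) then 1 else 1 / 3).
    assert (Hx0 : core_box G x0).
    { split; [intros; apply continuous_const|split; intros e t He; unfold x0].
      + rewrite (proj2 (Nat.ltb_lt _ _) He); lra.
      + rewrite (proj2 (Nat.ltb_ge _ _) He); lra. }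
    intros e t. unfold x0 at 1. destruct (Hbox x0 Hx0) as [_ [H1 H2]].
    apply Rabs_le. destruct (Nat.ltb_spec e (nE G)) as [He|He].
    + specialize (H1 e t He); lra.
    + specialize (H2 e t He); lra.
  - exists y; split; [auto|split; [|split; [|auto]]].
    + intros e t He Ht. rewrite <- Hfix at 1. unfold core_map.
      rewrite (proj2 (Nat.ltb_lt _ _) He), clamp_id by auto. reflexivity.
    + rewrite <- Hfix at 1. unfold core_map. rewrite Nat.ltb_irrefl. reflexivity.
Qed.

(** * Energy and matching *)

(** Divergence theorem: all Kirchhoff sums except the one at the half-line vertex vanish, so that
    one carries the whole source. *)
Lemma gop_root_flux G gam g :
  wf_graph G -> is_green G gam -> (hvert G 0 < nV G)%nat ->
  vdiv G (seq 0 (nE G)) (fun e => dgop G gam g e 0) (fun e => - dgop G gam g e (len G e)) (hvert G 0) =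
  rsum (nE G) (fun e => RInt (g e) 0 (len G e)).
Proof.
  intros [Hw _] Hgr Hv0.
  set (vd := vdiv G (seq 0 (nE G)) (fun e => dgop G gam g e 0) (fun e => - dgop G gam g e (len G e))).
  rewrite <- (rsum_indicator (nV G) (hvert G 0) vd Hv0).
  transitivity (rsum (nV G) (fun v => 1 * vd v)).
  - apply lsum_ext; intros v Hv; apply in_seq in Hv.
    destruct (Nat.eqb_spec (hvert G 0) v) as [_|Hne]; [ring|].
    unfold vd; rewrite gop_kirchhoff; auto; [ring|lia].
  - unfold vd. rewrite <- (vdiv_by_parts G (seq 0 (nE G)) (fun _ => 1)).
    + apply lsum_ext; intros e _. rewrite dgop_orig; unfold dgop, int1; ring.
    + intros e He; apply in_seq in He; split; apply Hw; lia.
Qed.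

(* With [M = int y^2] and [D = kap * flux], set [H = A/2 + kap (B/p - s M/2)].
   Testing the equation with [y] gives
   [A/2 - kap B/p = H/2 - D/4 + kap B (p-6)/(4p)], and [potential_convex] gives
   [H <= (3 A - K D^2)/2]. *)
Lemma core_energy G gam p kap al C y :
  wf_graph G -> is_green G gam -> 6 <= p <= 7 -> 0 < kap -> 0 < C ->
  (forall v, (v < nV G)%nat -> v <> hvert G 0 ->
       vdiv G (seq 0 (nE G)) al (fun e => len G e - al e) v = 0) ->
  let K := rsum (nE G) (len G) in
  let gap := K ^ 3 - rsum (nE G) (fun e => al e ^ 3 + (len G e - al e) ^ 3) in
  let C1 := 2 * C + 4 * K ^ 2 in
  0 < gap -> 24 * C1 * kap <= 1 -> 108 * C1 * (12 * C * K + 2 * K ^ 3) * kap <= gap ->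
  core_box G y ->
  (forall e t, (e < nE G)%nat -> 0 <= t <= len G e ->
     y e t = 1 + kap * gop G gam (rho G p y) e t /\ Rabs (gop G gam (rho G p y) e t) <= 2 * C) ->
  y (nE G) 0 = 2 / p + kap * flux G p y ^ 2 -> Rabs (flux G p y) <= 2 * K ->
  let A := rsum (nE G) (fun e => RInt (fun x => (kap * dgop G gam (rho G p y) e x) ^ 2) 0 (len G e)) in
  let B := rsum (nE G) (fun e => RInt (fun x => Rpower (y e x) p) 0 (len G e)) in
  0 <= flux G p y /\ 0 <= B <= 2 * K /\
  / 2 * A - kap / p * B + kap * flux G p y / 4 <=
    - (kap ^ 2 * gap / 12) + kap * B * ((p - 6) / (4 * p)).
Proof.
  intros Hwf Hgr Hp Hk HC Hal K gap C1 Hgap HkC Hkg Hy Hfix Hsig Hfl A B.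
  set (g := rho G p y) in *. set (n := flux G p y) in *. set (s := y (nE G) 0) in *.
  assert (Hlen : forall e, (e < nE G)%nat -> 0 < len G e) by (intros; apply Hwf; auto).
  assert (HK0 : 0 <= K) by (apply lsum_nonneg; intros e He; apply in_seq in He; left; apply Hlen; lia).
  assert (Hs : 1 / 4 <= s <= 1 / 2) by (apply core_box_sig; auto).
  assert (Cy : forall e t, continuous (y e) t) by apply Hy.
  assert (Cg : forall e t, continuous (g e) t) by (intros; apply rho_continuous; auto).
  assert (Cz : forall e t, continuous (gop G gam g e) t)
    by (intros; eapply is_derive_continuous, is_derive_gop; auto).
  assert (Cdz : forall e t, continuous (dgop G gam g e) t)
    by (intros; eapply is_derive_continuous, is_derive_dgop; auto).
  (* [r] is [nl] at v = 1 and s = 2/p. Both the profile and the frequency deviate from these values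
     by at most [C1 * kap], and 12 is the Lipschitz constant of [nl]. *)
  set (r := 1 - 2 / p). set (eps := 12 * (C1 * kap)).
  assert (Hr : 2 / 3 <= r <= 1).
  { unfold r, Rdiv. assert (/ p <= / 6) by (apply Rinv_le_contravar; lra).
    assert (0 < / p) by (apply Rinv_0_lt_compat; lra). lra. }
  assert (Hp2 : 1 / 4 <= 2 / p <= 1 / 2).
  { unfold Rdiv. assert (/ 7 <= / p) by (apply Rinv_le_contravar; lra).
    assert (/ p <= / 6) by (apply Rinv_le_contravar; lra). lra. }
  assert (HK2 : 0 <= K ^ 2) by apply pow2_ge_0.
  assert (HC1 : 0 <= C1) by (unfold C1; lra).
  assert (Heps : 0 <= eps <= 1 / 2).
  { unfold eps; split; [repeat apply Rmult_le_pos; lra|lra]. }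
  assert (Hnear : forall e t, (e < nE G)%nat -> 0 <= t <= len G e -> Rabs (g e t - r) <= eps).
  { intros e t He Ht. destruct (Hfix e t He Ht) as [E Hz].
    replace r with (nl p (2 / p) 1) by (unfold nl, r, Rpower; rewrite ln_1, Rmult_0_r, exp_0; ring).
    unfold g, rho; fold s. apply nl_lipschitz; auto; [apply Hy; auto|lra| |].
    - rewrite E. replace (1 + kap * gop G gam g e t - 1) with (kap * gop G gam g e t) by ring.
      rewrite Rabs_mult, (Rabs_pos_eq kap) by lra. unfold C1. nra.
    - rewrite Hsig. replace (2 / p + kap * n ^ 2 - 2 / p) with (kap * n ^ 2) by ring.
      rewrite Rabs_mult, (Rabs_pos_eq kap), <- RPow_abs by lra.
      assert (Rabs n ^ 2 <= (2 * K) ^ 2) by (apply pow_incr; split; [apply Rabs_pos|auto]).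
      unfold C1. nra. }
  set (Az := rsum (nE G) (fun e => RInt (fun x => dgop G gam g e x ^ 2) 0 (len G e))).
  assert (HAz : 3 * Az <= r ^ 2 * rsum (nE G) (fun e => al e ^ 3 + (len G e - al e) ^ 3) + 6 * eps * (2 * C) * K).
  { apply gop_energy_le; auto; [lra|lra|]. intros e x He Hx; split; [apply Hnear; auto|].
    destruct (Hfix e x He Hx); auto. }
  assert (HAz' : Az = rsum (nE G) (fun e => RInt (fun x => g e x * gop G gam g e x) 0 (len G e)))
    by (apply gop_energy; auto).
  assert (Hn : K * (r - eps) <= n).
  { unfold n, flux, K. rewrite Rmult_comm.
    change (rsum (nE G)) with (lsum (seq 0 (nE G))). rewrite <- lsum_scal.
    apply lsum_le; intros e He; apply in_seq in He.
    assert (He' : (e < nE G)%nat) by lia. specialize (Hlen e He').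
    replace ((r - eps) * len G e) with (RInt (fun _ => r - eps) 0 (len G e))
      by (rewrite RInt_const; unfold scal; simpl; unfold mult; simpl; ring).
    apply RInt_le; [lra|apply ex_RInt_const|apply ex_RInt_cont, Cg|].
    intros x Hx. assert (H := Hnear e x He' ltac:(lra)). apply Rabs_le_between in H. unfold g in H; lra. }
  assert (Hn0 : 0 <= n) by (assert (0 <= K * (r - eps)) by (apply Rmult_le_pos; lra); lra).
  assert (HA : A = kap ^ 2 * Az).
  { unfold A, Az. change (rsum (nE G)) with (lsum (seq 0 (nE G))). rewrite <- lsum_scal.
    apply lsum_ext; intros e _. rewrite <- RInt_scal_R by (intros; apply continuous_sq; auto).
    apply RInt_ext; intros x _; simpl; apply Rminus_diag_uniq; ring. }
  assert (Hpos : forall e t, 0 < y e t) by (intros; apply core_box_pos with G; auto).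
  assert (CB : forall e t, continuous (fun x => Rpower (y e x) p) t).
  { intros e t; apply (continuous_comp (y e) (fun v => Rpower v p)); auto.
    apply continuous_Rpower; auto. }
  assert (CM : forall e t, continuous (fun x => y e x ^ 2) t) by (intros; apply continuous_sq; auto).
  set (M := rsum (nE G) (fun e => RInt (fun x => y e x ^ 2) 0 (len G e))).
  (* Integrate rho y = rho + kap rho z; the left side is y^p - s y^2. *)
  assert (HBM : B - s * M = n + kap * Az).
  { rewrite HAz'. replace (B - s * M) with (B + (- s) * M) by ring.
    unfold B, M, n, flux; change (rsum (nE G)) with (lsum (seq 0 (nE G))).
    rewrite <- !lsum_scal, <- !lsum_plus; apply lsum_ext; intros e He; apply in_seq in He.
    assert (He' : (e < nE G)%nat) by lia.
    rewrite <- RInt_scal_R by auto. rewrite <- RInt_scal_R by (intros; apply continuous_mult_R; auto).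
    rewrite <- !RInt_plus_R;
      try (intros; try apply continuous_scal_R; auto; apply continuous_mult_R; auto).
    apply RInt_ext. rewrite Rmin_left, Rmax_right by (left; auto).
    intros x Hx. destruct (Hfix e x He' ltac:(lra)) as [E _].
    apply Rminus_diag_uniq. fold g.
    replace (g e x + kap * (g e x * gop G gam g e x)) with (g e x * y e x) by (rewrite E; ring).
    unfold g, rho, nl; fold s. replace p with ((p - 1) + 1) at 1 by ring.
    rewrite Rpower_plus, Rpower_1 by auto. ring. }
  (* [potential_convex] integrated; by the matching condition its constant 1/p - s/2 is - kap n^2 /
     2. *)
  assert (HF : B / p - s / 2 * M <= - (kap * n ^ 2 / 2) * K + kap * Az).
  { rewrite HAz'. replace (B / p - s / 2 * M) with (/ p * B + (- (s / 2)) * M) by (field; lra).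
    unfold B, M, K; change (rsum (nE G)) with (lsum (seq 0 (nE G))).
    rewrite <- !lsum_scal, <- !lsum_plus; apply lsum_le; intros e He; apply in_seq in He.
    assert (He' : (e < nE G)%nat) by lia.
    assert (Cgz : forall x, continuous (fun x => g e x * gop G gam g e x) x)
      by (intros; apply continuous_mult_R; auto).
    replace (- (kap * n ^ 2 / 2) * len G e) with (RInt (fun _ => - (kap * n ^ 2 / 2)) 0 (len G e))
      by (rewrite RInt_const; unfold scal; simpl; unfold mult; simpl; ring).
    rewrite <- !RInt_scal_R by auto.
    rewrite <- !RInt_plus_R;
      try (intros; try apply continuous_scal_R; auto); try apply continuous_const.
    apply RInt_le; [left; auto| | |].
    - apply ex_RInt_cont; intros; apply continuous_plus_R; apply continuous_scal_R; auto.
    - apply ex_RInt_cont; intros; apply continuous_plus_R; [apply continuous_const|apply continuous_scal_R; auto].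
    - intros x Hx. destruct (Hfix e x He' ltac:(lra)) as [E _].
      assert (H := potential_convex p s (y e x) Hp Hs (proj1 (proj2 Hy) e x He')).
      change (nl p s (y e x)) with (g e x) in H. rewrite E in H at 3.
      assert (Hps : / p - s / 2 = - (kap * n ^ 2 / 2)) by (rewrite Hsig; field; lra).
      unfold Rdiv in *; lra. }
  assert (HB : 0 <= B <= 2 * K).
  { assert (H := fun h => lsum_RInt_abs_le G (fun e x => Rpower (y e x) p) 2 Hwf CB h).
    split.
    - apply lsum_nonneg; intros e He; apply in_seq in He.
      apply RInt_ge_0; [left; apply Hlen; lia|apply ex_RInt_cont; auto|intros; left; apply exp_pos].
    - eapply Rle_trans; [apply Rle_abs|]. apply H. intros e t He Ht.
      rewrite Rabs_pos_eq by (left; apply exp_pos).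
      assert (H1 := proj1 (proj2 Hy) e t He).
      apply Rle_trans with ((11 / 10) ^ 7); [apply Rpower_le_pow; simpl; lra|simpl; lra]. }
  split; [auto|split; [auto|]].
  assert (Hn2 : K ^ 2 * (r ^ 2 - 2 * eps) <= n ^ 2).
  { apply Rle_trans with ((K * (r - eps)) ^ 2).
    - replace ((K * (r - eps)) ^ 2) with (K ^ 2 * (r ^ 2 - 2 * r * eps + eps ^ 2)) by ring.
      apply Rmult_le_compat_l; auto. assert (0 <= eps ^ 2) by apply pow2_ge_0. nra.
    - apply pow_incr; split; [apply Rmult_le_pos; lra|auto]. }
  assert (Hn3 : K ^ 3 * (r ^ 2 - 2 * eps) <= n ^ 2 * K).
  { replace (K ^ 3 * (r ^ 2 - 2 * eps)) with (K ^ 2 * (r ^ 2 - 2 * eps) * K) by ring.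
    apply Rmult_le_compat_r; auto. }
  (* Main term and errors: r >= 2/3 yields - (4/9) gap, and the factor 108 = 9 * 12 in the
     hypothesis limits all errors in [eps] to gap / 9, leaving - gap / 3. *)
  assert (Hgr2 : 4 / 9 * gap <= r ^ 2 * gap) by (apply Rmult_le_compat_r; [lra|nra]).
  assert (Hepsgap : eps * (12 * C * K + 2 * K ^ 3) <= gap / 9) by (unfold eps; lra).
  assert (Hmain : 3 * Az - n ^ 2 * K <= - (gap / 3)) by (unfold gap in *; lra).
  assert (Hk2 : kap ^ 2 * (3 * Az - n ^ 2 * K) <= kap ^ 2 * (- (gap / 3)))
    by (apply Rmult_le_compat_l; [apply pow2_ge_0|auto]).
  assert (HkF : kap * (B / p - s / 2 * M) <= kap * (- (kap * n ^ 2 / 2) * K + kap * Az))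
    by (apply Rmult_le_compat_l; lra).
  assert (HkBM : kap * (B - s * M) = kap * n + kap ^ 2 * Az) by (rewrite HBM; ring).
  rewrite HA.
  (* The summand with factor 1/4 vanishes by [HkBM]; the first one is at most kap^2 (3 Az - n^2 K) /
     4. *)
  replace (/ 2 * (kap ^ 2 * Az) - kap / p * B + kap * n / 4) with
    (/ 2 * (/ 2 * (kap ^ 2 * Az) + kap * (B / p - s / 2 * M))
     + / 4 * (kap * n + kap ^ 2 * Az - kap * (B - s * M)) + kap * B * ((p - 6) / (4 * p)))
    by (field; lra).
  rewrite HkBM. lra.
Qed.

(** * Rescaling by [eta] and assembly of the solution *)

Lemma Rpower_scaled eta kap p v :
  0 < eta -> 0 < v -> Rpower eta (p - 2) = kap ->
  Rpower (eta * v) (p - 1) = eta * (kap * Rpower v (p - 1)) /\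
  Rpower (eta * v) p = eta ^ 2 * kap * Rpower v p.
Proof.
  intros He Hv Hk. rewrite <- !Rpower_mult_distr by auto.
  assert (H1 : Rpower eta (p - 1) = eta * kap).
  { replace (p - 1) with ((p - 2) + 1) by ring. rewrite Rpower_plus, Rpower_1, Hk by auto; ring. }
  assert (H2 : Rpower eta p = eta ^ 2 * kap).
  { replace p with ((p - 1) + 1) at 1 by ring. rewrite Rpower_plus, Rpower_1, H1 by auto; ring. }
  rewrite H1, H2; split; ring.
Qed.

Lemma is_RInt_gen_scaled (f g : R -> R) k I :
  is_RInt_gen f (at_point 0) (Rbar_locally p_infty) I -> (forall x, g x = k * f x) ->
  is_RInt_gen g (at_point 0) (Rbar_locally p_infty) (k * I).
Proof.
  intros Hf Hg.
  apply (is_RInt_gen_ext (fun x => k * f x)).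
  - apply filter_forall; intros ab x _; symmetry; apply Hg.
  - apply (is_RInt_gen_scal f k I Hf).
Qed.

Lemma rsum_RInt_scaled (G : MGraph) (f g : nat -> R -> R) k :
  wf_graph G -> (forall e t, continuous (f e) t) ->
  (forall e x, (e < nE G)%nat -> 0 <= x <= len G e -> g e x = k * f e x) ->
  rsum (nE G) (fun e => RInt (g e) 0 (len G e)) = k * rsum (nE G) (fun e => RInt (f e) 0 (len G e)).
Proof.
  intros [Hw _] Cf H. change (rsum (nE G)) with (lsum (seq 0 (nE G))).
  rewrite <- lsum_scal; apply lsum_ext; intros e He; apply in_seq in He.
  destruct (Hw e) as [_ [_ Hl]]; [lia|].
  rewrite <- RInt_scal_R by auto. apply RInt_ext.
  rewrite Rmin_left, Rmax_right by lra. intros x Hx; apply H; [lia|lra].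
Qed.

Theorem theorem1p3 (G : MGraph) :
  wf_graph G -> connected G -> no_pendant G ->
  nH G = 1%nat -> (0 < nE G)%nat ->
  exists delta : R, 0 < delta /\
    forall p : R, 6 <= p <= 6 + delta ->
      exists mu : R, 0 < mu /\
        exists (lam : R) (ub dub uh duh : nat -> R -> R),
          nls_solution G p lam ub dub uh duh /\
          mass G ub uh = mu /\
          energy G p ub dub uh duh < 0.
Proof.
  intros Hwf Hc Hnp HH HE.
  assert (Hv0 : (hvert G 0 < nV G)%nat) by (apply Hwf; lia).
  destruct (exists_cheap_flow G Hwf Hc Hnp HH HE) as [al [Hal Hflow]].
  destruct (exists_discrete_green G Hwf Hc Hv0) as [gam Hgam].
  change (is_green G gam) in Hgam.
  destruct (gop_bound G gam Hwf) as [C [HC Hgop]].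
  set (K := rsum (nE G) (len G)) in *.
  assert (Hlen : forall e, (e < nE G)%nat -> 0 < len G e) by (intros; apply Hwf; auto).
  assert (HK : 0 < K).
  { apply Rlt_le_trans with (len G 0); [auto|]. unfold K.
    rewrite <- (rsum_indicator (nE G) 0 (len G) HE).
    apply lsum_le; intros e He; apply in_seq in He.
    destruct (Nat.eqb 0 e); [lra|left; apply Hlen; lia]. }
  set (gap := K ^ 3 - rsum (nE G) (fun e => al e ^ 3 + (len G e - al e) ^ 3)).
  assert (Hgap : 0 < gap) by (unfold gap; lra).
  set (C1 := 2 * C + 4 * K ^ 2).
  assert (HK2 : 0 <= K ^ 2) by apply pow2_ge_0.
  assert (HK3 : 0 <= K ^ 3) by (apply pow_le; lra).
  assert (HC1 : 0 < C1) by (unfold C1; lra).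
  assert (HCK : 0 <= 12 * C * K + 2 * K ^ 3).
  { assert (0 <= 12 * C * K) by (repeat apply Rmult_le_pos; lra). lra. }
  set (N := 108 * C1 * (12 * C * K + 2 * K ^ 3)).
  assert (HN : 0 <= N) by (repeat apply Rmult_le_pos; lra).
  assert (HNg : 0 <= N / gap) by (apply Rmult_le_pos; [lra|left; apply Rinv_0_lt_compat; lra]).
  (* Chosen before p. Since 24 C1 = 48 C + 96 K^2, the first term covers both smallness conditions
     of the fixed point; the second keeps the errors below [gap]. *)
  set (kap := / (24 * C1 + N / gap + 1)).
  assert (Hk : 0 < kap) by (apply Rinv_0_lt_compat; lra).
  assert (Hkinv : kap * (24 * C1 + N / gap + 1) = 1) by (apply Rinv_l; lra).
  assert (HkC : 24 * C1 * kap <= 1) by nra.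
  assert (HkN : N * kap <= gap).
  { replace (N * kap) with (gap * (kap * (N / gap))) by (field; lra).
    assert (kap * (N / gap) <= 1) by nra. nra. }
  assert (Hsk : 0 < sqrt kap) by (apply sqrt_lt_R0; auto).
  (* Bound, independent of p, for the integral of v^p over the whole graph. *)
  set (Smax := 2 * K + 4 / sqrt kap).
  assert (HS : 0 < Smax).
  { unfold Smax. assert (0 < 4 / sqrt kap) by (apply Rmult_lt_0_compat; [lra|apply Rinv_0_lt_compat; lra]). lra. }
  (* As 4 p >= 24, the terms in p - 6 then amount to at most kap^2 gap / 24, half of the gain kap^2
     gap / 12. *)
  set (d0 := kap * gap / Smax).
  assert (Hd0 : 0 < d0) by (repeat apply Rmult_lt_0_compat; auto; apply Rinv_0_lt_compat; auto).
  exists (Rmin 1 d0); split; [apply Rmin_glb_lt; lra|].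
  intros p Hp.
  assert (Hp7 : 6 <= p <= 7) by (generalize (Rmin_l 1 d0); lra).
  assert (Hpd : p - 6 <= d0) by (generalize (Rmin_r 1 d0); lra).
  destruct (core_fixed_point G gam C p kap Hwf Hp7 Hk HC Hgop) as [y [Hy [Hfix [Hsig Hfl]]]].
  { unfold C1 in HkC. nra. }
  { fold K. unfold C1 in HkC. nra. }
  fold K in Hfl.
  set (g := rho G p y) in *. set (n := flux G p y) in *. set (s := y (nE G) 0) in *.
  assert (Cg : forall e t, continuous (g e) t) by (intros; apply rho_continuous; auto).
  destruct (core_energy G gam p kap al C y Hwf Hgam Hp7 Hk HC Hal) as [Hn [HB HEcore]];
    auto.
  { intros e t He Ht; split; [apply Hfix; auto|].
    rewrite Rmult_comm. apply Hgop; auto; [lra|intros; apply rho_bound; auto]. }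
  fold K in HB. fold g n in HB, HEcore. fold n in Hn. fold K in HEcore. fold gap in HEcore.
  set (A := rsum (nE G) (fun e => RInt (fun x => (kap * dgop G gam g e x) ^ 2) 0 (len G e))) in *.
  set (B := rsum (nE G) (fun e => RInt (fun x => Rpower (y e x) p) 0 (len G e))) in *.
  assert (Hs : 1 / 4 <= s <= 1 / 2) by (apply core_box_sig; auto).
  destruct (half_line_solution p kap s (kap * n) Hp7 Hk Hs) as
    [v [dv [Mh [Ah [Bh [Hv_0 [Hdv_0 [Hode [HMh [HAh [HBh [HMh0 [Hid HBh0]]]]]]]]]]]]].
  { apply Rmult_le_pos; lra. }
  { rewrite Hsig; ring. }
  set (eta := Rpower kap (/ (p - 2))).
  assert (Heta : 0 < eta) by apply exp_pos.
  assert (Hetak : Rpower eta (p - 2) = kap).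
  { unfold eta; rewrite Rpower_mult, Rinv_l, Rpower_1; lra. }
  assert (Hpos : forall e t, 0 < y e t) by (intros; apply core_box_pos with G; auto).
  (* [y] is clamped and need not be differentiable at the ends of an edge; [w] agrees with it on the
     edge and is differentiable on both sides of the ends. *)
  set (w := fun e x => 1 + kap * gop G gam g e x).
  assert (Hwy : forall e x, (e < nE G)%nat -> 0 <= x <= len G e -> w e x = y e x)
    by (intros; symmetry; apply Hfix; auto).
  set (ub := fun e x => eta * w e x). set (dub := fun e x => eta * (kap * dgop G gam g e x)).
  set (uh := fun (h : nat) x => eta * v x). set (duh := fun (h : nat) x => eta * dv x).
  assert (IM : forall h, is_RInt_gen (fun x => uh h x ^ 2) (at_point 0) (Rbar_locally p_infty) (eta ^ 2 * Mh)).
  { intros h; apply (is_RInt_gen_scaled (fun x => v x ^ 2)); auto. intros x; unfold uh; ring. }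
  assert (IA : forall h, is_RInt_gen (fun x => duh h x ^ 2) (at_point 0) (Rbar_locally p_infty) (eta ^ 2 * Ah)).
  { intros h; apply (is_RInt_gen_scaled (fun x => dv x ^ 2)); auto. intros x; unfold duh; ring. }
  assert (IB : forall h, is_RInt_gen (fun x => Rpower (uh h x) p) (at_point 0) (Rbar_locally p_infty)
     (eta ^ 2 * kap * Bh)).
  { intros h; apply (is_RInt_gen_scaled (fun x => Rpower (v x) p)); auto.
    intros x; unfold uh; apply Rpower_scaled; auto; apply Hode. }
  assert (Hrs1 : forall f : nat -> R, rsum (nH G) f = f 0%nat)
    by (intros f; rewrite HH; unfold rsum; simpl; ring).
  assert (Cy : forall e t, continuous (y e) t) by apply Hy.
  exists (mass G ub uh); split; [|exists (kap * s), ub, dub, uh, duh; split; [|split; [reflexivity|]]].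
  - unfold mass. rewrite Hrs1, (is_RInt_gen_unique _ _ (IM 0%nat)).
    assert (H1 : 0 <= eta ^ 2 * Mh) by (apply Rmult_le_pos; [apply pow2_ge_0|auto]).
    rewrite (rsum_RInt_scaled G (fun e x => y e x ^ 2) (fun e x => ub e x ^ 2) (eta ^ 2)); auto.
    2:{ intros; apply continuous_sq; auto. }
    2:{ intros e x He Hx; unfold ub; rewrite Hwy by auto; ring. }
    assert (H2 : / 2 * K <= rsum (nE G) (fun e => RInt (fun x => y e x ^ 2) 0 (len G e))).
    { unfold K; change (rsum (nE G)) with (lsum (seq 0 (nE G))). rewrite <- lsum_scal.
      apply lsum_le; intros e He; apply in_seq in He. assert (He' : (e < nE G)%nat) by lia.
      specialize (Hlen e He').
      replace (/ 2 * len G e) with (RInt (fun _ => / 2) 0 (len G e))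
        by (rewrite RInt_const; unfold scal; simpl; unfold mult; simpl; ring).
      apply RInt_le; [lra|apply ex_RInt_const|apply ex_RInt_cont; intros; apply continuous_sq; auto|].
      intros x _. assert (H := proj1 (proj2 Hy) e x He'). nra. }
    assert (H3 : 0 < eta ^ 2) by (apply pow_lt; auto).
    assert (H4 : 0 < eta ^ 2 * rsum (nE G) (fun e => RInt (fun x => y e x ^ 2) 0 (len G e)))
      by (apply Rmult_lt_0_compat; lra).
    lra.
  - split; [|split; [|split; [|split]]].
    + intros e x He Hx. assert (Hw' := Hwy e x He Hx). split; [|split].
      * unfold ub; rewrite Hw'; apply Rmult_lt_0_compat; auto.
      * apply (is_derive_scal (w e)). unfold w.
        eapply is_derive_ext_l_eq.
        -- apply (is_derive_plus (fun _ => 1) (fun x => kap * gop G gam g e x)).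
           ++ apply @is_derive_const.
           ++ apply (is_derive_scal (gop G gam g e)), is_derive_gop; auto.
        -- unfold plus, zero; simpl; ring.
      * eapply is_derive_ext_l_eq.
        -- apply (is_derive_scal (fun x => kap * dgop G gam g e x)).
           apply (is_derive_scal (dgop G gam g e)), is_derive_dgop; auto.
        -- unfold ub; rewrite Hw'.
           rewrite (proj1 (Rpower_scaled eta kap p (y e x) Heta (Hpos e x) Hetak)).
           unfold g, rho, nl; fold s; ring.
    + intros h x _ _. destruct (Hode x) as [H1 [H2 H3]]. split; [|split].
      * apply Rmult_lt_0_compat; auto.
      * apply (is_derive_scal v); auto.
      * eapply is_derive_ext_l_eq; [apply (is_derive_scal dv), H3|].
        unfold uh. rewrite (proj1 (Rpower_scaled eta kap p (v x) Heta H1 Hetak)). ring.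
    + intros h _; split; [|split]; eexists; [apply IM|apply IA|apply IB].
    + exists (fun u => eta * (1 + kap * nod G gam g u)); split.
      * intros e He; unfold ub, w. rewrite gop_orig, gop_term; auto.
      * intros h Hh. assert (h = 0%nat) by lia; subst h.
        unfold uh; rewrite nod_root, Hv_0 by auto; ring.
    + intros u Hu. rewrite Hrs1.
      change (vdiv G (seq 0 (nE G)) (fun e => dub e 0) (fun e => - dub e (len G e)) u +
        (if Nat.eqb (hvert G 0) u then duh 0%nat 0 else 0) = 0).
      rewrite (vdiv_ext _ _ _ _ (fun e => eta * kap * dgop G gam g e 0)
        (fun e => eta * kap * - dgop G gam g e (len G e))) by (intros; unfold dub; split; ring).
      rewrite (vdiv_scal G (seq 0 (nE G)) (eta * kap) (fun e => dgop G gam g e 0)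
        (fun e => - dgop G gam g e (len G e))).
      destruct (Nat.eqb_spec (hvert G 0) u) as [E|E].
      * subst u. rewrite gop_root_flux by auto.
        change (rsum (nE G) (fun e => RInt (g e) 0 (len G e))) with n.
        unfold duh; rewrite Hdv_0; ring.
      * rewrite gop_kirchhoff by auto; ring.
  - unfold energy. rewrite !Hrs1.
    rewrite (is_RInt_gen_unique _ _ (IA 0%nat)), (is_RInt_gen_unique _ _ (IB 0%nat)).
    rewrite (rsum_RInt_scaled G (fun e x => (kap * dgop G gam g e x) ^ 2) (fun e x => dub e x ^ 2) (eta ^ 2));
      auto.
    2:{ intros; apply continuous_sq, continuous_scal_R.
        eapply is_derive_continuous, is_derive_dgop; auto. }
    2:{ intros; unfold dub; ring. }
    rewrite (rsum_RInt_scaled G (fun e x => Rpower (y e x) p) (fun e x => Rpower (ub e x) p) (eta ^ 2 * kap)); auto.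
    2:{ intros e t; apply (continuous_comp (y e) (fun v => Rpower v p)); auto.
        apply continuous_Rpower; auto. }
    2:{ intros e x He Hx; unfold ub; rewrite Hwy by auto. apply Rpower_scaled; auto. }
    fold A B.
    (* The term kap n / 4 is the D/4 that cancels against the same quantity in [HEcore]. *)
    assert (Hh : / 2 * Ah - kap / p * Bh = kap * n / 4 + kap * Bh * ((p - 6) / (4 * p))).
    { replace Ah with ((kap * n + kap * (1 - 2 / p) * Bh) / 2) by lra. field; lra. }
    assert (Hq : 0 <= (p - 6) / (4 * p) <= d0 / 24).
    { assert (/ p <= / 6) by (apply Rinv_le_contravar; lra).
      assert (0 < / p) by (apply Rinv_0_lt_compat; lra).
      replace ((p - 6) / (4 * p)) with ((p - 6) * / p / 4) by (field; lra).
      assert ((p - 6) * / p <= d0 * / 6) by (apply Rmult_le_compat; lra).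
      assert (0 <= (p - 6) * / p) by (apply Rmult_le_pos; lra). lra. }
    assert (Hcorr : kap * (B + Bh) * ((p - 6) / (4 * p)) <= kap ^ 2 * gap / 24).
    { replace (kap ^ 2 * gap / 24) with (kap * Smax * (d0 / 24)) by (unfold d0; field; lra).
      apply Rmult_le_compat; try lra.
      - apply Rmult_le_pos; lra.
      - apply Rmult_le_compat_l; [lra|unfold Smax; lra]. }
    assert (Hkg : 0 < kap ^ 2 * gap) by (apply Rmult_lt_0_compat; [apply pow_lt|]; auto).
    replace (/ 2 * (eta ^ 2 * A + eta ^ 2 * Ah) - / p * (eta ^ 2 * kap * B + eta ^ 2 * kap * Bh))
      with (eta ^ 2 * ((/ 2 * A - kap / p * B) + (/ 2 * Ah - kap / p * Bh))) by (field; lra).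
    assert (Htot : (/ 2 * A - kap / p * B) + (/ 2 * Ah - kap / p * Bh) < 0) by (rewrite Hh; lra).
    assert (H3 : 0 < eta ^ 2) by (apply pow_lt; auto).
    nra.
Qed.
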